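(* Let $\Delta=\frac12S^{ab}\partial_b\partial_a+T^a\partial_a$ be an arbitrary odd second order operator on functions on $M$ (so $\Delta(1)=0$), such that the odd bracket generated by $\Delta$ is a Schouten (odd Poisson) bracket, i.e. $(S,S)=0$ for $S=\frac12S^{ab}p_bp_a$. The properties that $\Delta$ is a derivation of the corresponding Schouten bracket and that $\Delta^2$ is a Poisson vector field are each equivalent to the flatness of the upper connection: $$D\gamma=0,$$ where $D=(S,\ )$ and $\gamma=\gamma^ap_a$, $\gamma^a=\partial_bS^{ba}-2T^a$.
   Context: Let $M$ be a supermanifold with local coordinates $x^a$ of parity $\tilde a$, $\partial_a=\partial/\partial x^a$, $p_a$ the conjugate momenta on $T^*M$, and $(\ ,\ )$ the canonical even Poisson bracket on $T^*M$. The coefficients satisfy $S^{ab}=(-1)^{\tilde a\tilde b}S^{ba}$, and $\Delta$ is odd. The bracket generated by $\Delta$ is $\{f,g\}=\Delta(fg)-(\Delta f)g-(-1)^{\tilde f}f\,\Delta g=S^{ab}\partial_bf\,\partial_ag(-1)^{\tilde a\tilde f}=((S,f),g)$; it satisfies the Jacobi identity $$(-1)^{\tilde f\tilde h}\{\{f,g\},h\}+(-1)^{\tilde h\tilde g}\{\{h,f\},g\}+(-1)^{\tilde g\tilde f}\{\{g,h\},f\}=0$$ exactly when $(S,S)=0$, and is then called a Schouten (odd Poisson) bracket. The coefficients $\gamma^a=\partial_bS^{ba}-2T^a$ transform as $\gamma^{a'}=(\gamma^a+S^{ab}\partial_b\log J)\,\partial x^{a'}/\partial x^a$, $J=Dx'/Dx$,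 and define the upper connection in the bundle of volume forms; $\gamma=\gamma^ap_a$ is a local function on $T^*M$ and the upper connection is called flat if $D\gamma=(S,\gamma)=0$. $\Delta$ is a derivation of the bracket if $\Delta\{f,g\}=-\{\Delta f,g\}-(-1)^{\tilde f}\{f,\Delta g\}$ (the opening bracket is odd). A (even) vector field $X$ is Poisson if $X\{f,g\}=\{Xf,g\}+\{f,Xg\}$. *)

(* Defs.v *)
From HB Require Import structures.
From mathcomp Require Import all_boot all_order all_algebra.
From mathcomp Require Import all_classical all_reals all_analysis.

Set Implicit Arguments.
Unset Strict Implicit.
Unset Printing Implicit Defensive.

Import Order.TTheory GRing.Theory Num.Theory.
Import numFieldNormedType.Exports.

Local Open Scope classical_set_scope.
Local Open Scope ring_scope.

(** * The model: superfunctions of n even and m odd variables *)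

(* F : sfun R n m stands for \sum_I F I * xi^I, where xi^I is the product of
   the odd coordinates xi_j, j in I, in increasing order.  Superfunctions on an
   open W are represented by total functions compared on W only (eq_on). *)
Notation sfun R n m := ({set 'I_m} -> 'rV[R]_n -> R).

(* Coordinate indices a: inl for even coordinates, inr for odd ones. *)
Definition ix (n m : nat) : finType := ('I_n + 'I_m)%type.

Definition par {n m} (a : ix n m) : bool := if a is inr _ then true else false.

Section Model.
Context {R : realType} {n m : nat}.
Implicit Types (F G : sfun R n m) (W : set 'rV[R]_n) (p : bool).

Definition eq_on W F G := forall (I : {set 'I_m}) x, W x -> F I x = G I x.

Definition shomog W p F :=
  forall (I : {set 'I_m}) x, W x -> odd #|I| != p -> F I x = 0.

Definition sconst (c : R) : sfun R n m := fun I _ => if I == finset.set0 then c else 0.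

Definition scoord (a : ix n m) : sfun R n m := fun I x =>
  match a with
  | inl i => if I == finset.set0 then x 0 i else 0
  | inr j => (I == [set j]%SET)%:R
  end.

(* xi^J * xi^K = (-1) ^ inversions J K * xi^(J :|: K) for disjoint J, K *)
Definition inversions (J K : {set 'I_m}) : nat :=
  #|[set u : 'I_m * 'I_m | [&& u.1 \in J, u.2 \in K & (u.2 < u.1)%N]]%SET|.

Definition smul F G : sfun R n m := fun I x =>
  \sum_(J : {set 'I_m} | J \subset I)
    (-1) ^+ inversions J (I :\: J)%SET * (F J x * G (I :\: J)%SET x).

Definition sscale (c : R) F : sfun R n m := fun I x => c * F I x.

(* The parity involution F |-> (-1)^(parity of F) F, applied p times. *)
Definition stwist p F : sfun R n m := fun I x => (-1) ^+ (p * #|I|) * F I x.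

Definition partial (i : 'I_n) (f : 'rV[R]_n -> R) : 'rV[R]_n -> R :=
  'D_(delta_mx 0 i) f.

(* Partial derivatives; left derivatives in the odd directions. *)
Definition pd (a : ix n m) F : sfun R n m := fun I x =>
  match a with
  | inl i => partial i (F I) x
  | inr j => if j \in I then 0
             else (-1) ^+ #|[set k in I | (k < j)%N]%SET| * F (j |: I)%SET x
  end.

(* C^infty on the open set W: all iterated partial derivatives exist and are
   continuous at the points of W. *)
Definition smooth_on W (f : 'rV[R]_n -> R) :=
  forall s : seq 'I_n, let g := foldr partial f s in
  forall x, W x ->
    {for x, continuous g} /\ forall i, derivable g x (delta_mx 0 i).

Definition ssmooth_on W F := forall I : {set 'I_m}, smooth_on W (F I).

End Model.

(** * The cotangent bundle of a coordinate domain *)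

(* T^*W has coordinates x^a (the left halves of 'I_(n + n) and 'I_(m + m)) and
   momenta p_a of the same parity (the right halves). *)
Section Cotangent.
Context {R : realType} {n m : nat}.
Implicit Types (a : ix n m) (F G : sfun R (n + n) (m + m)).

Definition pos_ix a : ix (n + n) (m + m) :=
  match a with inl i => inl (lshift n i) | inr j => inr (lshift m j) end.

Definition mom_ix a : ix (n + n) (m + m) :=
  match a with inl i => inl (rshift n i) | inr j => inr (rshift m j) end.

Definition mom a : sfun R (n + n) (m + m) := scoord (mom_ix a).

Definition cotangent (W : set 'rV[R]_n) : set 'rV[R]_(n + n) :=
  [set z | W (lsubmx z)].

(* Pull-back of superfunctions along the projection of the cotangent bundle. *)
Definition pull (F : sfun R n m) : sfun R (n + n) (m + m) := fun I z =>
  if [forall k in I, (k < m)%N] then F [set j | lshift m j \in I]%SET (lsubmx z)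
  else 0.

(* The canonical even Poisson bracket: for homogeneous F of parity p it is
   (F, G) = \sum_a (-1)^(a(p+1)) dF/dp_a dG/dx^a - (-1)^(a p) dF/dx^a dG/dp_a,
   a in the exponents denoting the parity of x^a.  With this normalization
   (p_a, x^b) = delta_a^b, and the bracket {f, g} generated by an odd
   Delta is ((S, f), g). *)
Definition poisson F G : sfun R (n + n) (m + m) :=
  \sum_(a : ix n m)
    (sscale ((-1) ^+ par a)
       (smul (pd (mom_ix a) (stwist (par a) F)) (pd (pos_ix a) G))
     - smul (pd (pos_ix a) (stwist (par a) F)) (pd (mom_ix a) G)).

(* S = 1/2 S^{ab} p_b p_a *)
Definition symbol (S : ix n m -> ix n m -> sfun R n m) :
    sfun R (n + n) (m + m) :=
  sscale 2^-1 (\sum_a \sum_b smul (pull (S a b)) (smul (mom b) (mom a))).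

(* gamma = gamma^a p_a with gamma^a = d_b S^{ba} - 2 T^a *)
Definition upper_connection (S : ix n m -> ix n m -> sfun R n m)
    (T : ix n m -> sfun R n m) : sfun R (n + n) (m + m) :=
  \sum_a smul (pull (\sum_b pd b (S b a) - sscale 2 (T a))) (mom a).

End Cotangent.

(** * Supermanifolds *)

(* Supercommutative R-superalgebras.  The zero algebra is allowed (it is the
   algebra of sections over the empty set), whence pzRingType and a ring
   morphism sa_scal from the scalars instead of algType. *)
Record superalgebra (R : realType) := Superalgebra {
  sa_ring :> pzRingType;
  sa_scal : {rmorphism R -> sa_ring};
  homog : bool -> set sa_ring;
  homogB : forall p f g, homog p f -> homog p g -> homog p (f - g);
  homog_scal : forall c, homog false (sa_scal c);
  homogM : forall p q f g, homog p f -> homog q g -> homog (p (+) q) (f * g);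
  homog_sum : forall f,
    exists f0 f1, [/\ homog false f0, homog true f1 & f = f0 + f1];
  homog_cap : forall f, homog false f -> homog true f -> f = 0;
  supercomm : forall (p q : bool) f g,
    homog p f -> homog q g -> f * g = (-1) ^+ (p && q) * (g * f)
}.

(* A topological space with a sheaf of superalgebras.  Only the values on open
   sets matter: a sheaf defined on open sets extends to all sets by taking
   interiors. *)
Record superspace (R : realType) := Superspace {
  pt : topologicalType;
  sec : set pt -> superalgebra R;
  res : forall U V : set pt, V `<=` U -> {rmorphism sec U -> sec V};
  res_scal : forall U V (h : V `<=` U) c,
    res h (sa_scal (sec U) c) = sa_scal (sec V) c;
  res_homog : forall U V (h : V `<=` U) p f,
    homog p f -> homog p (res h f);
  res_id : forall U (h : U `<=` U) f, res h f = f;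
  res_comp : forall U V W (h1 : V `<=` U) (h2 : W `<=` V) (h : W `<=` U) f,
    res h2 (res h1 f) = res h f;
  sheaf_sep : forall (C : set (set pt)) U, open U -> C `<=` open ->
    \bigcup_(V in C) V = U -> forall f g : sec U,
    (forall V (h : V `<=` U), C V -> res h f = res h g) -> f = g;
  sheaf_glue : forall (C : set (set pt)) U, open U -> C `<=` open ->
    \bigcup_(V in C) V = U -> forall s : (forall V, sec V),
    (forall V V' (h : V `&` V' `<=` V) (h' : V `&` V' `<=` V'),
      C V -> C V' -> res h (s V) = res h' (s V')) ->
    exists f : sec U, forall V (h : V `<=` U), C V -> res h f = s V
}.

(* A chart: an isomorphism of an open subspace of M onto an open subspace of
   R^{n|m}, given by a homeomorphism cmap of cdom onto an open set of R^n and
   the expression coef of sections in the coordinates. *)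
Record chart (R : realType) (n m : nat) (M : superspace R) := Chart {
  cdom : set (pt M);
  cmap : pt M -> 'rV[R]_n;
  coef : forall V : set (pt M), sec V -> sfun R n m;
  cdom_open : open cdom;
  cmap_inj : set_inj cdom cmap;
  cmap_cont : forall x, cdom x -> {for x, continuous cmap};
  cmap_open : forall V, open V -> V `<=` cdom -> open (cmap @` V);
  coef_smooth : forall V, open V -> V `<=` cdom -> forall f : sec V,
    ssmooth_on (cmap @` V) (coef f);
  coef_inj : forall V, open V -> V `<=` cdom -> forall f g : sec V,
    eq_on (cmap @` V) (coef f) (coef g) -> f = g;
  coef_surj : forall V, open V -> V `<=` cdom -> forall F : sfun R n m,
    ssmooth_on (cmap @` V) F ->
    exists f : sec V, eq_on (cmap @` V) (coef f) F;
  coefD : forall V, open V -> V `<=` cdom -> forall f g : sec V,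
    eq_on (cmap @` V) (coef (f + g)) (coef f + coef g);
  coefM : forall V, open V -> V `<=` cdom -> forall f g : sec V,
    eq_on (cmap @` V) (coef (f * g)) (smul (coef f) (coef g));
  coef_scal : forall V, open V -> V `<=` cdom -> forall c : R,
    eq_on (cmap @` V) (coef (sa_scal (sec V) c)) (sconst c);
  coef_homog : forall V, open V -> V `<=` cdom -> forall p (f : sec V),
    homog p f <-> shomog (cmap @` V) p (coef f);
  coef_res : forall V W (h : W `<=` V), open V -> V `<=` cdom -> open W ->
    forall f : sec V, eq_on (cmap @` W) (coef (res h f)) (coef f)
}.

Record supermanifold (R : realType) (n m : nat) := Supermanifold {
  sm_space :> superspace R;
  sm_hausdorff : hausdorff_space (pt sm_space);
  sm_countable : @second_countable (pt sm_space);
  sm_chart : forall x : pt sm_space, exists c : chart n m sm_space, cdom c x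
}.

(** * Operators on functions *)

(* R-linear endomorphisms of the structure sheaf. *)
Record operator (R : realType) (M : superspace R) := Operator {
  op :> forall U : set (pt M), {additive sec U -> sec U};
  op_scal : forall U c (f : sec U),
    op U (sa_scal (sec U) c * f) = sa_scal (sec U) c * op U f;
  op_res : forall U V (h : V `<=` U) f, res h (op U f) = op V (res h f)
}.

Section Operators.
Context {R : realType} {M : superspace R}.
Implicit Types (D X : operator M) (U : set (pt M)).

Definition op_comp D X : operator M.
Proof.
exists (fun U => D U \o X U : {additive sec U -> sec U}) => /=.
- by move=> U c f; rewrite !op_scal.
- by move=> U V h f; rewrite !op_res.
Defined.

Definition op_homog (p : bool) D := forall U, open U ->
  forall q (f : sec U), homog q f -> homog (p (+) q) (D U f).

(* {f, g} for f homogeneous of parity p *)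
Definition bracket D U (p : bool) (f g : sec U) : sec U :=
  D U (f * g) - D U f * g - (-1) ^+ p * (f * D U g).

Definition bracket_derivation D := forall U, open U ->
  forall p (f g : sec U), homog p f ->
    D U (bracket D p f g) =
      - bracket D (~~ p) (D U f) g - (-1) ^+ p * bracket D p f (D U g).

Definition even_vector_field X := op_homog false X /\
  forall U, open U -> forall f g : sec U, X U (f * g) = X U f * g + f * X U g.

Definition poisson_vector_field D X := even_vector_field X /\
  forall U, open U -> forall p (f g : sec U), homog p f ->
    X U (bracket D p f g) = bracket D p (X U f) g + bracket D p f (X U g).

(* D = 1/2 S^{ab} d_b d_a + T^a d_a on the chart c, for D odd *)
Definition local_form {n m} D (c : chart n m M)
    (S : ix n m -> ix n m -> sec (cdom c)) (T : ix n m -> sec (cdom c)) :=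
  [/\ forall a b, S a b = (-1) ^+ (par a && par b) * S b a,
      forall a b, homog (par a (+) par b (+) true) (S a b),
      forall a, homog (par a (+) true) (T a) &
      forall V, open V -> V `<=` cdom c -> forall f : sec V,
        eq_on (cmap c @` V) (coef c (D V f))
          (sscale 2^-1
             (\sum_a \sum_b smul (coef c (S a b)) (pd b (pd a (coef c f))))
           + \sum_a smul (coef c (T a)) (pd a (coef c f)))].

Definition odd_second_order (n m : nat) D := op_homog true D /\
  forall c : chart n m M, exists S T, local_form D (c := c) S T.

(* (S, S) = 0 in all coordinates *)
Definition schouten (n m : nat) D :=
  forall (c : chart n m M) S T, local_form D (c := c) S T ->
  let s := symbol (fun a b => coef c (S a b)) in
  eq_on (cotangent (cmap c @` cdom c)) (poisson s s) 0.

(* (S, gamma) = 0 in all coordinates *)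
Definition flat_upper_connection (n m : nat) D :=
  forall (c : chart n m M) S T, local_form D (c := c) S T ->
  let Sc := fun a b => coef c (S a b) in
  let Tc := fun a => coef c (T a) in
  eq_on (cotangent (cmap c @` cdom c))
    (poisson (symbol Sc) (upper_connection Sc Tc)) 0.

End Operators.

(* Main.v *)
From HB Require Import structures.
From mathcomp Require Import all_boot all_order all_algebra.
From mathcomp Require Import all_classical all_reals all_analysis.
From mathcomp Require Import ring.
Require Import Defs.

(** Why the theorem holds.

Let {f, g} be the bracket generated by Delta.  Expanding the brackets gives, for
every odd operator, the identity (derivation_defect)
  Delta {f, g} + {Delta f, g} + (-1)^f {f, Delta g}
    = Delta^2 (f g) - (Delta^2 f) g - f (Delta^2 g).
So Delta is a derivation of its bracket if and only if Delta^2 is a derivation of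
the product, and then Delta^2 is automatically a Poisson vector field: apply the
derivation property of Delta twice.  Both properties in the theorem thus say that
Delta^2 is a vector field, and this can be decided chart by chart because the
functions form a sheaf.

In a chart, write Delta = s^{ab} d_b d_a + T^a d_a with s = S/2.  Composing the
operator with itself (second_order_sqr), the contributions that pair two
coefficients without differentiating either of them cancel, because the
coefficients times the derivatives are odd; what remains is
  Delta^2 = C3 d d d + C2 d d + C1 d.
Replacing the derivatives by momenta turns such an operator into a polynomial on
the cotangent bundle, its symbol, and conversely the symbol determines the
operator, because differentiating it in the momenta recovers the symmetrized
coefficients (symb3_op3, symb2_op2).  The cubic symbol is (S, S)/2 (symb3_C3).
The quadratic symbol is
  - (S, gamma)/2 + div (S, S)/4,
where div is the sum of all d/dx^a d/dp_a (symb2_C2 and divergence_contraction;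
symb2_C2_Gamma for (S, S) = 0).  If (S, S) = 0, only C2 d d stands between Delta^2
and a vector field, and its symbol is - (S, gamma)/2.  Flatness therefore makes
Delta^2 the vector field C1 d.  Conversely, if Delta^2 is a derivation, its values
on the products x^a x^b show that the symmetrized C2 is zero, hence that
(S, gamma) = 0.

All these computations are made in one ring: the superfunctions on the cotangent
bundle of the image of the chart.  Functions on the chart are pulled back to it,
where Delta acts by the same formula with the momenta as parameters.  This ring
is an instance of the structure supercalculus, which lists the rules used.  In
coordinates the rules rest on the sign rules of the exterior algebra (exsignA,
exsignC, exsign_leibniz) and on the symmetry of mixed derivatives (derive_comm). *)

Set Implicit Arguments.
Unset Strict Implicit.
Unset Printing Implicit Defensive.

Import Order.TTheory GRing.Theory Num.Theory.
Import numFieldNormedType.Exports.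

Local Open Scope ring_scope.

(** * Symmetry of mixed derivatives *)

Section Schwarz.
Local Open Scope classical_set_scope.
Context {R : realType} {V : normedModType R}.
Implicit Types (f : V -> R) (x u v : V).

Lemma derive_shift f w x u : 'D_u (fun y => f (w + y)) x = 'D_u f (w + x).
Proof.
rewrite /derive; set F := (X in lim (X @ _) = _); set G := (X in _ = lim (X @ _)).
by suff -> : F = G by []; apply/funext => h; rewrite /F /G /= addrCA.
Qed.

Lemma derivable_shift f w x u :
  derivable f (w + x) u -> derivable (fun y => f (w + y)) x u.
Proof.
rewrite /derivable; set F := (X in X @ _); set G := (X in _ -> cvg (X @ _)).
by suff -> : F = G by []; apply/funext => h; rewrite /F /G /= addrCA.
Qed.

(** Reduces directional derivatives to derivatives of functions of one real
variable, for which there is a mean value theorem. *)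
Lemma is_derive_line f x u (s : R) : derivable f (s *: u + x) u ->
  is_derive s 1 (fun t : R => f (t *: u + x)) ('D_u f (s *: u + x)).
Proof.
have e (h : R) : (h *: 1 + s) *: u + x = h *: u + (s *: u + x).
  by rewrite scalerDl addrA [h *: 1]mulr1.
have E : (fun h => h^-1 *: (((fun t : R => f (t *: u + x)) \o shift s) (h *: 1)
    - f (s *: u + x))) =
    (fun h => h^-1 *: ((f \o shift (s *: u + x)) (h *: u) - f (s *: u + x))).
  by apply/funext => h /=; rewrite e.
by move=> d; apply: DeriveDef; rewrite /derivable /derive E.
Qed.

Lemma line_MVT f x u (c : R) : 0 < c ->
  (forall s, 0 <= s <= c -> derivable f (s *: u + x) u) ->
  exists2 s, 0 < s < c & f (c *: u + x) - f x = c * 'D_u f (s *: u + x).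
Proof.
move=> c0 d.
have [||s] := @MVT R (fun t : R => f (t *: u + x))
   (fun s => 'D_u f (s *: u + x)) 0 c c0.
- move=> s; rewrite in_itv /= => /andP[s0 sc].
  by apply: is_derive_line; apply: d; rewrite !ltW.
- apply: derivable_within_continuous => s; rewrite in_itv /= => /d.
  by move=> /is_derive_line [].
rewrite in_itv /= scale0r add0r subr0 => sc ->; exists s => //.
by rewrite mulrC.
Qed.

(** Two applications of the mean value theorem, first along u and then along v.  The
left-hand side is symmetric in u and v, which is the source of the symmetry of
the mixed derivatives. *)
Lemma second_difference f x u v (h : R) : 0 < h ->
  (forall s t, 0 <= s <= h -> 0 <= t <= h ->
     derivable f (t *: v + (s *: u + x)) u /\
     derivable ('D_u f) (t *: v + (s *: u + x)) v) ->
  exists s t, [/\ 0 < s < h, 0 < t < h &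
    f (h *: v + (h *: u + x)) - f (h *: u + x) - (f (h *: v + x) - f x) =
    h * (h * 'D_v ('D_u f) (t *: v + (s *: u + x)))].
Proof.
move=> h0 d.
have hh : 0 <= h <= h by rewrite lexx ltW.
have h00 : (0 : R) <= 0 <= h by rewrite lexx ltW.
have d0 s : 0 <= s <= h -> derivable f (s *: u + x) u.
  by move=> sh; have [+ _] := d s 0 sh h00; rewrite scale0r add0r.
have dh s : 0 <= s <= h -> derivable (fun y => f (h *: v + y)) (s *: u + x) u.
  by move=> sh; have [+ _] := d s h sh hh; apply: derivable_shift.
have [s|s sh es] := @line_MVT ((fun y => f (h *: v + y)) - f) x u h h0.
  by move=> sh; apply: derivableB; [apply: dh | apply: d0].
have sh' : 0 <= s <= h by case/andP: sh => ? ?; rewrite !ltW.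
move: es; rewrite deriveB; [|exact: dh|exact: d0].
rewrite derive_shift.
have [t th|t th et] := @line_MVT ('D_u f) (s *: u + x) v h h0.
  by have [] := d s t sh' th.
by rewrite et => es; exists s, t; split.
Qed.

Lemma dist_halves (a b c e : R) :
  `|b - c| < e / 2 -> `|a - c| < e / 2 -> `|a - b| <= e.
Proof.
move=> bc ac; apply: (le_trans (ler_distD c _ _)); rewrite (splitr e) distrC.
by apply: lerD; apply: ltW => //; rewrite distrC.
Qed.

(** The second difference of step h equals h^2 times either mixed derivative at some
point of the parallelogram spanned by h u and h v; by continuity both values tend
to the values at x when h tends to 0. *)
Lemma derive_comm (W : set V) f x u v : open W -> W x ->
  (forall y, W y -> [/\ derivable f y u, derivable f y v,
     derivable ('D_u f) y v & derivable ('D_v f) y u]) ->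
  {for x, continuous ('D_v ('D_u f))} -> {for x, continuous ('D_u ('D_v f))} ->
  'D_u ('D_v f) x = 'D_v ('D_u f) x.
Proof.
move=> oW Wx d c1 c2; apply/eqP; rewrite -subr_eq0 -normr_le0.
apply/ler_addgt0Pl => e e0; rewrite addr0.
have e2 : 0 < e / 2 by rewrite divr_gt0.
have H1 : nbhs x W by exact: open_nbhs_nbhs.
have H2 : \forall y \near x, `|'D_v ('D_u f) x - 'D_v ('D_u f) y| < e / 2.
  by move/cvgrPdist_lt : c1 => /(_ _ e2).
have H3 : \forall y \near x, `|'D_u ('D_v f) x - 'D_u ('D_v f) y| < e / 2.
  by move/cvgrPdist_lt : c2 => /(_ _ e2).
have [r /= r0 Hr'] := (nbhs_ballP x _).1 (filterI H1 (filterI H2 H3)).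
have Hr y : `|x - y| < r -> W y /\ `|'D_v ('D_u f) x - 'D_v ('D_u f) y| < e / 2 /\
    `|'D_u ('D_v f) x - 'D_u ('D_v f) y| < e / 2.
  by move=> xy; apply: Hr'; rewrite -ball_normE.
(* With this step the whole parallelogram stays within distance r of x. *)
pose h := r / (`|u| + `|v| + 1).
have k0 : 0 < `|u| + `|v| + 1 by rewrite ltr_wpDl ?addr_ge0.
have h0 : 0 < h by rewrite divr_gt0.
have near_x s t : 0 <= s <= h -> 0 <= t <= h -> `|x - (t *: v + (s *: u + x))| < r.
  move=> /andP[s0 sh] /andP[t0 th].
  rewrite addrA opprD addrCA subrr addr0 normrN.
  apply: (le_lt_trans (ler_normD _ _)); rewrite !normrZ !ger0_norm //.
  apply: (@le_lt_trans _ _ (h * `|v| + h * `|u|)).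
    by apply: lerD; apply: ler_wpM2r.
  by rewrite -mulrDr /h mulrAC -mulrA gtr_pMr // ltr_pdivrMr // mul1r [`|v| + _]addrC ltrDl.
have [s [t [sh th e1]]] := @second_difference f x u v h h0 (fun s t hs ht =>
  let: And4 d1 _ d3 _ := d _ (Hr _ (near_x s t hs ht)).1 in conj d1 d3).
have [|t' [s' [th' sh' e1']]] := @second_difference f x v u h h0.
  move=> t' s' hs ht; have -> : s' *: u + (t' *: v + x) = t' *: v + (s' *: u + x).
    exact: addrCA.
  by have [_ d2 _ d4] := d _ (Hr _ (near_x s' t' ht hs)).1.
have E : 'D_v ('D_u f) (t *: v + (s *: u + x)) = 'D_u ('D_v f) (s' *: u + (t' *: v + x)).
  apply: (mulfI (lt0r_neq0 h0)); apply: (mulfI (lt0r_neq0 h0)).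
  have E0 : h *: u + (h *: v + x) = h *: v + (h *: u + x) by exact: addrCA.
  apply: etrans (esym e1) (etrans _ e1'); rewrite E0.
  by move: (f _) (f _) (f _) (f _) => k1 k2 k3 k4; ring.
have w k : 0 < k < h -> 0 <= k <= h by move=> /andP[? ?]; rewrite !ltW.
have [_ [q1 _]] := Hr _ (near_x s t (w _ sh) (w _ th)).
have [_ [_ q2]] := Hr _ (near_x s' t' (w _ sh') (w _ th')).
have E1 : s' *: u + (t' *: v + x) = t' *: v + (s' *: u + x) by exact: addrCA.
rewrite E1 in E; rewrite -E in q2.
exact: dist_halves q1 q2.
Qed.

End Schwarz.

(** * Smooth functions on open sets *)

Section Smooth.
Local Open Scope classical_set_scope.
Context {R : realType} {n : nat}.
Implicit Types (f g : 'rV[R]_n -> R) (W : set 'rV[R]_n) (x : 'rV[R]_n) (i j : 'I_n).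

(** What smoothness requires of each iterated partial derivative at a point. *)
Definition regular_at f x :=
  {for x, continuous f} /\ forall i, derivable f x (delta_mx 0 i).

Lemma open_near_eq W f g x : open W -> W x -> (forall y, W y -> f y = g y) ->
  \forall y \near x, f y = g y.
Proof.
move=> oW Wx fg; apply: (filterS _ (open_nbhs_nbhs (conj oW Wx))); exact: fg.
Qed.

Lemma regular_eq W f g x : open W -> W x -> (forall y, W y -> f y = g y) ->
  regular_at f x -> regular_at g x.
Proof.
move=> oW Wx fg [cf df]; have nfg := open_near_eq oW Wx fg.
split; last by move=> i; apply: near_eq_derivable (df i).
by move: cf; rewrite /prop_for /continuous_at -(fg x Wx); apply: cvg_trans;
  exact: near_eq_cvg nfg.
Qed.

Lemma partial_eq W f g i x : open W -> W x -> (forall y, W y -> f y = g y) ->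
  partial i f x = partial i g x.
Proof. by move=> oW Wx fg; apply: near_eq_derive; exact: open_near_eq fg. Qed.

(** Coinduction principle: a class of functions that are regular on W and that is
closed under partial derivatives, up to equality on W, consists of smooth
functions.  It avoids formulas for the iterated derivatives of a product. *)
Lemma smooth_coind W (C : ('rV[R]_n -> R) -> Prop) : open W ->
  (forall f, C f -> forall x, W x -> regular_at f x) ->
  (forall f i, C f -> exists g, C g /\ forall x, W x -> partial i f x = g x) ->
  forall f, C f -> smooth_on W f.
Proof.
move=> oW Creg Cpart f Cf s.
have [g [Cg fg]] : exists g, C g /\ forall x, W x -> foldr partial f s x = g x.
  elim: s => [|i s [g [Cg fg]]]; first by exists f.
  have [h [Ch gh]] := Cpart g i Cg; exists h; split=> // x Wx /=.
  by rewrite (partial_eq _ oW Wx fg) gh.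
by move=> /= x Wx; apply: (regular_eq oW Wx (fun y Wy => esym (fg y Wy))); apply: Creg.
Qed.

Lemma smooth_regular W f x : smooth_on W f -> W x -> regular_at f x.
Proof. by move=> sf Wx; apply: (sf [::]). Qed.

Lemma smooth_partial W f i : smooth_on W f -> smooth_on W (partial i f).
Proof. by move=> sf s; have := sf (rcons s i); rewrite foldr_rcons. Qed.

Lemma smooth_eq W f g : open W -> (forall x, W x -> f x = g x) ->
  smooth_on W f -> smooth_on W g.
Proof.
move=> oW fg sf.
apply: (@smooth_coind W (fun h => exists2 k, smooth_on W k & forall x, W x -> k x = h x)) => //.
- move=> h [k sk kh] x Wx; apply: (regular_eq oW Wx kh); exact: smooth_regular sk Wx.
- move=> h i [k sk kh]; exists (partial i k); split.
    by exists (partial i k); first exact: smooth_partial.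
  by move=> x Wx; apply/esym/(partial_eq _ oW Wx kh).
by exists f.
Qed.

Lemma smooth_mono W W' f : W' `<=` W -> smooth_on W f -> smooth_on W' f.
Proof. by move=> sW sf s g x /sW Wx; apply: sf. Qed.

Lemma partial_cst (c : R) i x : partial i (fun=> c) x = 0.
Proof. exact: derive_cst. Qed.

Lemma partialD f g i x : regular_at f x -> regular_at g x ->
  partial i (fun y => f y + g y) x = partial i f x + partial i g x.
Proof. by move=> [_ df] [_ dg]; exact: deriveD. Qed.

Lemma partialM f g i x : regular_at f x -> regular_at g x ->
  partial i (fun y => f y * g y) x = partial i f x * g x + f x * partial i g x.
Proof.
by move=> [_ df] [_ dg]; rewrite addrC [X in _ + X]mulrC; exact: deriveM.
Qed.

Lemma regular_cst (c : R) x : regular_at (fun=> c) x.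
Proof. by split=> [|i]; [exact: cst_continuous | exact: derivable_cst]. Qed.

Lemma regularD f g x : regular_at f x -> regular_at g x ->
  regular_at (fun y => f y + g y) x.
Proof.
move=> [cf df] [cg dg]; split=> [|i]; first exact: continuousD.
exact: derivableD.
Qed.

Lemma regularM f g x : regular_at f x -> regular_at g x ->
  regular_at (fun y => f y * g y) x.
Proof.
move=> [cf df] [cg dg]; split=> [|i]; first exact: continuousM.
exact: derivableM.
Qed.

Lemma coord_growth j x (v : 'rV[R]_n) :
  (fun h : R => h^-1 *: (((fun y : 'rV[R]_n => y 0 j) \o shift x) (h *: v) - x 0 j))
    @ 0^' --> v 0 j.
Proof.
set F := (X in X @ _ --> _).
have E : \forall h \near (0 : R)^', (fun=> v 0 j) h = F h.
  apply/nbhs_ballP; exists 1 => //= h _ h0 /=.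
  by rewrite /F /= !mxE addrK [_ *: _]mulrA mulVf // mul1r.
exact: (cvg_trans (near_eq_cvg E) (cvg_cst (v 0 j))).
Qed.

Lemma partial_coord j i x : partial i (fun y => y 0 j) x = (i == j)%:R.
Proof.
have -> : (i == j)%:R = (delta_mx 0 i : 'rV[R]_n) 0 j by rewrite mxE eqxx eq_sym.
by rewrite /partial /derive; apply: cvg_lim; [exact: norm_hausdorff|exact: coord_growth].
Qed.

Lemma regular_coord j x : regular_at (fun y => y 0 j) x.
Proof.
split=> [|i]; first exact: coord_continuous.
by apply/cvg_ex; exists ((delta_mx 0 i : 'rV[R]_n) 0 j); apply: coord_growth.
Qed.

(** The polynomial expressions in smooth functions: closed under partial derivatives
up to equality on W by the rules of calculus, so that one use of smooth_coind
covers sums and products together. *)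
Inductive generated W : ('rV[R]_n -> R) -> Prop :=
| gen_smooth f : smooth_on W f -> generated W f
| gen_cst c : generated W (fun=> c)
| gen_coord j : generated W (fun y => y 0 j)
| genD f g : generated W f -> generated W g -> generated W (fun y => f y + g y)
| genM f g : generated W f -> generated W g -> generated W (fun y => f y * g y).

Lemma generated_regular W f x : generated W f -> W x -> regular_at f x.
Proof.
move=> gf Wx; elim: gf => [{}f sf|c|j|f1 f2 _ h1 _ h2|f1 f2 _ h1 _ h2].
- exact: smooth_regular sf Wx.
- exact: regular_cst.
- exact: regular_coord.
- exact: regularD.
- exact: regularM.
Qed.

Lemma generated_smooth W f : open W -> generated W f -> smooth_on W f.
Proof.
move=> oW; apply: smooth_coind => // [{}f gf x|{}f i gf]; first exact: generated_regular.
elim: gf => [{}f sf|c|j|f1 f2 g1 [h1 [k1 e1]] g2 [h2 [k2 e2]]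
            |f1 f2 g1 [h1 [k1 e1]] g2 [h2 [k2 e2]]].
- by exists (partial i f); split=> //; apply: gen_smooth; apply: smooth_partial.
- by exists (fun=> 0); split=> [|x _]; [exact: gen_cst | exact: partial_cst].
- by exists (fun=> (i == j)%:R); split=> [|x _]; [exact: gen_cst | exact: partial_coord].
- exists (fun y => h1 y + h2 y); split=> [|x Wx]; first exact: genD.
  by rewrite partialD ?e1 ?e2 //; apply: generated_regular Wx.
exists (fun y => h1 y * f2 y + f1 y * h2 y); split=> [|x Wx].
  by apply: genD; apply: genM.
by rewrite partialM ?e1 ?e2 //; apply: generated_regular Wx.
Qed.

Lemma smooth_cst W (c : R) : open W -> smooth_on W (fun=> c).
Proof. by move=> oW; apply: generated_smooth => //; exact: gen_cst. Qed.

Lemma smooth_coord W j : open W -> smooth_on W (fun y => y 0 j).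
Proof. by move=> oW; apply: generated_smooth => //; exact: gen_coord. Qed.

Lemma smoothD W f g : open W -> smooth_on W f -> smooth_on W g ->
  smooth_on W (fun y => f y + g y).
Proof.
by move=> oW sf sg; apply: generated_smooth => //; apply: genD; apply: gen_smooth.
Qed.

Lemma smoothM W f g : open W -> smooth_on W f -> smooth_on W g ->
  smooth_on W (fun y => f y * g y).
Proof.
by move=> oW sf sg; apply: generated_smooth => //; apply: genM; apply: gen_smooth.
Qed.

Lemma smooth_sum W (J : Type) (r : seq J) (P : pred J) (F : J -> 'rV[R]_n -> R) :
  open W -> (forall k, smooth_on W (F k)) -> smooth_on W (fun y => \sum_(k <- r | P k) F k y).
Proof.
move=> oW sF; elim: r => [|k r IH].
  apply: (smooth_eq oW _ (smooth_cst 0 oW)) => y _; by rewrite big_nil.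
case Pk : (P k); last by apply: (smooth_eq oW _ IH) => y _; rewrite big_cons Pk.
by apply: (smooth_eq oW _ (smoothD oW (sF k) IH)) => y _; rewrite big_cons Pk.
Qed.

Lemma partial_sum W (J : Type) (r : seq J) (P : pred J) (F : J -> 'rV[R]_n -> R) i x :
  open W -> W x -> (forall k, smooth_on W (F k)) ->
  partial i (fun y => \sum_(k <- r | P k) F k y) x = \sum_(k <- r | P k) partial i (F k) x.
Proof.
move=> oW Wx sF; elim: r => [|k r IH].
  rewrite big_nil -[RHS](partial_cst 0 i x).
  by apply: (partial_eq _ oW Wx) => y _; rewrite big_nil.
rewrite big_cons; case Pk : (P k); last first.
  by rewrite -IH; apply: (partial_eq _ oW Wx) => y _; rewrite big_cons Pk.
rewrite -IH -partialD; first by apply: (partial_eq _ oW Wx) => y _; rewrite big_cons Pk.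
  exact: smooth_regular Wx.
by apply: smooth_regular Wx; exact: smooth_sum.
Qed.

Lemma partialC W f i j x : open W -> W x -> smooth_on W f ->
  partial i (partial j f) x = partial j (partial i f) x.
Proof.
move=> oW Wx sf; have reg s y : W y -> regular_at (foldr partial f s) y by exact: sf.
apply: (derive_comm oW Wx).
- move=> y Wy; split.
  + by have [_] := reg [::] y Wy; exact.
  + by have [_] := reg [::] y Wy; exact.
  + by have [_] := reg [:: i] y Wy; exact.
  + by have [_] := reg [:: j] y Wy; exact.
- by have [] := reg [:: j; i] x Wx.
- by have [] := reg [:: i; j] x Wx.
Qed.

End Smooth.

(** * Pull-back of functions to the cotangent bundle *)

Section Pullback.
Local Open Scope classical_set_scope.
Context {R : realType} {n : nat}.
Implicit Types (f : 'rV[R]_n -> R) (W : set 'rV[R]_n) (z : 'rV[R]_(n + n)) (i : 'I_n).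

Lemma lsubmx_delta_l i : lsubmx (delta_mx 0 (lshift n i) : 'rV[R]_(n + n)) = delta_mx 0 i.
Proof. by apply/rowP => k; rewrite !mxE (inj_eq (@lshift_inj _ _)). Qed.

Lemma lsubmx_delta_r i : lsubmx (delta_mx 0 (rshift n i) : 'rV[R]_(n + n)) = 0.
Proof. by apply/rowP => k; rewrite !mxE eq_lrshift andbF. Qed.

(** Directional derivatives of a pull-back are directional derivatives of the
function along the projected vector, which is 0 for the momentum directions. *)
Lemma growth_lsubmx f z v :
  (fun h : R => h^-1 *: (((fun y => f (lsubmx y)) \o shift z) (h *: v) - f (lsubmx z))) =
  (fun h : R => h^-1 *: ((f \o shift (lsubmx z)) (h *: lsubmx v) - f (lsubmx z))).
Proof.
apply/funext => h /=; congr (_ *: (f _ - _)).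
by apply/rowP => k; rewrite !mxE.
Qed.

Lemma partial_pull_l f i z :
  partial (lshift n i) (fun y => f (lsubmx y)) z = partial i f (lsubmx z).
Proof. by rewrite /partial /derive growth_lsubmx lsubmx_delta_l. Qed.

Lemma partial_pull_r f i z : partial (rshift n i) (fun y => f (lsubmx y)) z = 0.
Proof.
rewrite /partial /derive growth_lsubmx lsubmx_delta_r.
exact: (derive0 f (lsubmx z)).
Qed.

Lemma regular_pull f z : regular_at f (lsubmx z) ->
  regular_at (fun y : 'rV[R]_(n + n) => f (lsubmx y)) z.
Proof.
move=> [cf df]; split.
  have cl : {for z, continuous (lsubmx : 'rV[R]_(n + n) -> 'rV[R]_n)}.
    exact: continuous_lsubmx.
  exact: (continuous_comp cl cf).
move=> i; rewrite /derivable growth_lsubmx; case: (split_ordP i) => k ->.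
  by rewrite lsubmx_delta_l; exact: df.
by rewrite lsubmx_delta_r; exact: derivable0.
Qed.

Lemma open_cotangent W : open W -> open (cotangent W).
Proof.
move=> oW; rewrite (_ : cotangent W = lsubmx @^-1` W) //.
by apply: open_comp => // z _; exact: continuous_lsubmx.
Qed.

Lemma smooth_pull W f : open W -> smooth_on W f ->
  smooth_on (cotangent W) (fun y => f (lsubmx y)).
Proof.
move=> oW sf; apply: (@smooth_coind _ _ _ (fun h =>
  exists2 g, smooth_on W g & h = fun y => g (lsubmx y))).
- exact: open_cotangent.
- move=> h [g sg ->] z Wz; apply: regular_pull; exact: (smooth_regular sg Wz).
- move=> h i [g sg ->]; case: (split_ordP i) => k ->.
    exists (fun y => partial k g (lsubmx y)); split.
      by exists (partial k g); first exact: smooth_partial.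
    by move=> z _; exact: partial_pull_l.
  exists (fun=> 0); split; last by move=> z _; exact: partial_pull_r.
  by exists (fun=> 0); first exact: smooth_cst.
by exists f.
Qed.

End Pullback.

(** * Exterior multiplication of superfunctions *)

Section Exterior.
Import boot.finset.
Context {R : realType} {m : nat}.
Implicit Types (I J K L : {set 'I_m}) (j k : 'I_m).

Lemma inversionsE J K :
  inversions J K = (\sum_(j in J) \sum_(k in K) (k < j))%N.
Proof.
rewrite /inversions cardsE -sum1_card.
rewrite (eq_bigl (fun u : 'I_m * 'I_m => [&& u.1 \in J, u.2 \in K & (u.2 < u.1)%N])) //.
rewrite pair_big_dep /= [RHS](bigID (fun u : 'I_m * 'I_m => (u.2 < u.1)%N)) /=.
rewrite [X in (_ + X)%N]big1 ?addn0 => [|u /andP[_ /negbTE ->] //].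
rewrite big_mkcond [RHS]big_mkcond; apply: eq_bigr => u _ /=.
by case: (u.1 \in J); case: (u.2 \in K); case: ltnP.
Qed.

Lemma sum_setU J K (h : 'I_m -> nat) : [disjoint J & K] ->
  (\sum_(i in (J :|: K)%SET) h i = \sum_(i in J) h i + \sum_(i in K) h i)%N.
Proof.
by move=> dJK; rewrite (eq_bigl [predU J & K]) ?bigU // => i; rewrite !inE.
Qed.

Lemma inversionsUl J K L : [disjoint J & K] ->
  inversions (J :|: K)%SET L = (inversions J L + inversions K L)%N.
Proof. by move=> dJK; rewrite !inversionsE sum_setU. Qed.

Lemma inversionsUr J K L : [disjoint K & L] ->
  inversions J (K :|: L)%SET = (inversions J K + inversions J L)%N.
Proof.
move=> dKL; rewrite !inversionsE -big_split; apply: eq_bigr => j _.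
by rewrite sum_setU.
Qed.

Lemma inversionsC J K : [disjoint J & K] ->
  (inversions J K + inversions K J = #|J| * #|K|)%N.
Proof.
move=> dJK; rewrite !inversionsE [X in (_ + X)%N]exchange_big -big_split /=.
rewrite -sum_nat_const; apply: eq_bigr => j jJ.
rewrite -big_split -sum1_card; apply: eq_bigr => k kK /=.
have : j != k by apply: contraTneq kK => <-; rewrite (disjointFr dJK jJ).
by rewrite neq_ltn => /orP[] h; rewrite h ltnNge ltnW.
Qed.

(** The structure constants of the exterior algebra: xi^J xi^K is exsign J K times
xi^(J :|: K), for all J and K. *)
Definition exsign J K : R :=
  if [disjoint J & K] then (-1) ^+ inversions J K else 0.

(** The cocycle condition expressing the associativity of the exterior product; it
holds because inversions are counted additively over disjoint unions.  All other
sign rules are derived from it and from exsignC. *)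
Lemma exsignA J K L :
  exsign J K * exsign (J :|: K)%SET L = exsign K L * exsign J (K :|: L)%SET.
Proof.
rewrite /exsign.
have -> : [disjoint (J :|: K)%SET & L] = [disjoint J & L] && [disjoint K & L].
  by rewrite -!setI_eq0 setIUl setU_eq0.
have -> : [disjoint J & (K :|: L)%SET] = [disjoint J & K] && [disjoint J & L].
  by rewrite -!setI_eq0 setIUr setU_eq0.
have [dJK|_] := boolP [disjoint J & K]; last by rewrite mul0r /= mulr0.
have [dJL|_] := boolP [disjoint J & L]; last by rewrite !mulr0.
have [dKL|_] := boolP [disjoint K & L]; last by rewrite mulr0 mul0r.
rewrite /= -!exprD inversionsUl // inversionsUr //; congr (_ ^+ _).
by rewrite addnA addnC addnA.
Qed.

Lemma exsignC J K : exsign J K = (-1) ^+ (#|J| * #|K|) * exsign K J.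
Proof.
rewrite /exsign [in RHS]disjoint_sym; case: ifP => [dJK|]; last by rewrite mulr0.
by rewrite -inversionsC // exprD -mulrA -expr2 sqrr_sign mulr1.
Qed.

Lemma exsign0l K : exsign finset.set0 K = 1.
Proof.
rewrite /exsign -setI_eq0 set0I eqxx inversionsE big1 // => j.
by rewrite inE.
Qed.

Lemma exsign0r J : exsign J finset.set0 = 1.
Proof. by rewrite exsignC exsign0l mulr1 cards0 muln0. Qed.

Lemma exsign_card J K : exsign J K != 0 -> #|(J :|: K)%SET| = (#|J| + #|K|)%N.
Proof.
rewrite /exsign; case: ifP => [|_ /eqP//].
by rewrite -setI_eq0 cardsU => /eqP ->; rewrite cards0 subn0.
Qed.

(** The sign of the odd partial derivative is a structure constant, so that the
Leibniz rule also follows from exsignA. *)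
Lemma exsign1 j I :
  exsign [set j]%SET I = if j \in I then 0 else (-1) ^+ #|[set k in I | (k < j)%N]%SET|.
Proof.
rewrite /exsign disjoints1; case: (j \in I) => //=; congr (_ ^+ _).
rewrite inversionsE big_set1 -sum1_card big_mkcond [RHS]big_mkcond.
by apply: eq_bigr => k _; rewrite inE; case: (k \in I); case: ltnP.
Qed.

Context {n : nat}.
Implicit Types (F G H : sfun R n m) (x : 'rV[R]_n).

(** The sum over all pairs of index sets is symmetric in the two factors, unlike the
definition, and the delta factor makes sums over triples easy to rearrange. *)
Lemma smulE F G I x : smul F G I x =
  \sum_J \sum_K (J :|: K == I)%SET%:R * (exsign J K * (F J x * G K x)).
Proof.
rewrite /smul big_mkcond; apply: eq_bigr => J _.
case: ifP => [JI|/negP JI]; last first.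
  rewrite big1 // => K _; case: eqP => [e|_]; last by rewrite mul0r.
  by case: JI; rewrite -e finset.subsetUl.
rewrite (bigD1 (I :\: J)%SET) //= big1 => [|K nK].
  have -> : (J :|: I :\: J)%SET = I.
    by apply/setP => k; rewrite !inE; case: (boolP (k \in J)) => //= /(fintype.subsetP JI).
  rewrite eqxx mul1r addr0 /exsign ifT //.
  by rewrite -setI_eq0 setIDA setIC -setIDA setDv setI0.
case: eqP => [e|_]; last by rewrite mul0r.
rewrite /exsign; case: ifP => [d|_]; last by rewrite mul0r mulr0.
case/eqP: nK; rewrite -e; apply/setP => k; rewrite !inE.
by case: (boolP (k \in J)) => //= kJ; rewrite (disjointFr d kJ).
Qed.

Lemma smul_ext F F' G G' I x : (forall J, F J x = F' J x) ->
  (forall J, G J x = G' J x) -> smul F G I x = smul F' G' I x.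
Proof.
by move=> hF hG; apply: eq_bigr => J _; rewrite hF hG.
Qed.

Lemma sum_eq (T : finType) (a : T) (h : T -> R) : \sum_b (a == b)%:R * h b = h a.
Proof.
rewrite (bigD1 a) //= eqxx mul1r big1 ?addr0 // => b /negbTE.
by rewrite eq_sym => ->; rewrite mul0r.
Qed.

Lemma smulA F G H I x : smul F (smul G H) I x = smul (smul F G) H I x.
Proof.
transitivity (\sum_J \sum_K \sum_L (J :|: (K :|: L) == I)%SET%:R *
   (exsign K L * exsign J (K :|: L)%SET * (F J x * (G K x * H L x)))).
  transitivity (\sum_J \sum_M \sum_K \sum_L (K :|: L == M)%SET%:R *
    ((J :|: M == I)%SET%:R * (exsign K L * exsign J M * (F J x * (G K x * H L x))))).
    rewrite smulE; apply: eq_bigr => J _; apply: eq_bigr => M _.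
    rewrite smulE !mulr_sumr; apply: eq_bigr => K _.
    by rewrite !mulr_sumr; apply: eq_bigr => L _; ring.
  apply: eq_bigr => J _; rewrite exchange_big; apply: eq_bigr => K _ /=.
  by rewrite exchange_big; apply: eq_bigr => L _ /=; rewrite sum_eq.
transitivity (\sum_M \sum_L \sum_J \sum_K (J :|: K == M)%SET%:R *
    ((M :|: L == I)%SET%:R * (exsign J K * exsign M L * (F J x * (G K x * H L x))))).
  transitivity (\sum_J \sum_K \sum_L \sum_M (J :|: K == M)%SET%:R *
    ((M :|: L == I)%SET%:R * (exsign J K * exsign M L * (F J x * (G K x * H L x))))).
    apply: eq_bigr => J _; apply: eq_bigr => K _; apply: eq_bigr => L _.
    by rewrite sum_eq setUA -exsignA.
  rewrite [RHS]exchange_big /=; under [RHS]eq_bigr => L _ do rewrite exchange_big /=.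
  under [RHS]eq_bigr => L _ do under eq_bigr => J _ do rewrite exchange_big /=.
  rewrite [RHS]exchange_big /=; apply: eq_bigr => J _.
  by rewrite [RHS]exchange_big.
rewrite smulE; apply: eq_bigr => M _; apply: eq_bigr => L _.
rewrite smulE mulr_suml !mulr_sumr; apply: eq_bigr => J _.
by rewrite mulr_suml !mulr_sumr; apply: eq_bigr => K _; ring.
Qed.

Lemma smul1l F I x : smul (sconst 1) F I x = F I x.
Proof.
rewrite smulE (bigD1 set0) //= [X in _ + X]big1 ?addr0 => [|J /negbTE J0]; last first.
  by rewrite big1 // => K _; rewrite /sconst J0 mul0r !mulr0.
under eq_bigr => K _ do rewrite set0U exsign0l /sconst eqxx !mul1r eq_sym.
exact: sum_eq.
Qed.

Lemma smul1r F I x : smul F (sconst 1) I x = F I x.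
Proof.
rewrite smulE exchange_big (bigD1 set0) //= [X in _ + X]big1 ?addr0 => [|J /negbTE J0]; last first.
  by rewrite big1 // => K _; rewrite /sconst J0 !mulr0.
under eq_bigr => K _ do rewrite setU0 exsign0r /sconst eqxx mulr1 mul1r eq_sym.
exact: sum_eq.
Qed.

Lemma smulDl F G H I x : smul (F + G) H I x = smul F H I x + smul G H I x.
Proof.
rewrite -big_split; apply: eq_bigr => J _ /=; rewrite -mulrDr.
by rewrite (_ : (F + G) J x = F J x + G J x) // mulrDl.
Qed.

Lemma smulDr F G H I x : smul H (F + G) I x = smul H F I x + smul H G I x.
Proof.
rewrite -big_split; apply: eq_bigr => J _ /=; rewrite -mulrDr.
by congr (_ * _); rewrite -mulrDr.
Qed.

Lemma stwistM p F G I x :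
  stwist p (smul F G) I x = smul (stwist p F) (stwist p G) I x.
Proof.
rewrite /stwist !smulE mulr_sumr; apply: eq_bigr => J _.
rewrite mulr_sumr; apply: eq_bigr => K _.
case: eqP => [<-|_]; last by rewrite !mul0r mulr0.
have [->|/exsign_card ->] := eqVneq (exsign J K) 0; first by rewrite !mul0r !mulr0.
by rewrite mulnDr exprD; ring.
Qed.

Lemma stwistK p F I x : stwist p (stwist p F) I x = F I x.
Proof. by rewrite /stwist mulrA -expr2 sqrr_sign mul1r. Qed.

(** Stated at a single point, for the values there of parts of parities p and q. *)
Lemma smulC p q F G I x :
  (forall J, odd #|J| != p -> F J x = 0) -> (forall J, odd #|J| != q -> G J x = 0) ->
  smul F G I x = (-1) ^+ (p && q) * smul G F I x.
Proof.
move=> hF hG; rewrite !smulE exchange_big mulr_sumr; apply: eq_bigr => K _ /=.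
rewrite mulr_sumr; apply: eq_bigr => J _; rewrite setUC.
have [e1|/hF ->] := eqVneq (odd #|J|) p; last by rewrite !(mul0r, mulr0).
have [e2|/hG ->] := eqVneq (odd #|K|) q; last by rewrite !(mul0r, mulr0).
rewrite exsignC -[(-1) ^+ (#|J| * #|K|)]signr_odd oddM e1 e2; ring.
Qed.

Lemma pd_oddE j F I x : pd (inr j) F I x = exsign [set j]%SET I * F (j |: I)%SET x.
Proof. by rewrite /pd exsign1; case: ifP; rewrite ?mul0r. Qed.

Lemma pd_odd_twist j p F I x :
  pd (inr j) (stwist p F) I x = (-1) ^+ p * stwist p (pd (inr j) F) I x.
Proof.
rewrite /stwist !pd_oddE exsign1; case: ifP => jI; first by rewrite !mul0r !mulr0.
by rewrite cardsU1 jI /= mulnDr muln1 exprD; ring.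
Qed.

Lemma pd_oddC j k F I x :
  pd (inr j) (pd (inr k) F) I x = - pd (inr k) (pd (inr j) F) I x.
Proof.
have e a b : exsign [set a]%SET I * exsign [set b]%SET (a |: I)%SET =
    exsign [set b]%SET [set a]%SET * exsign (b |: [set a])%SET I :> R.
  by rewrite [RHS]exsignA.
have eC : exsign [set j]%SET [set k]%SET = - exsign [set k]%SET [set j]%SET :> R.
  have [->|jk] := eqVneq j k; first by rewrite /exsign disjoints1 set11 oppr0.
  by rewrite exsignC !cards1 mulN1r.
rewrite !pd_oddE setUCA !mulrA !e eC -[(j |: [set k])%SET]setUC.
by rewrite !mulNr opprK.
Qed.

Lemma sqr_exsign1 j K : j \notin K -> exsign [set j]%SET K * exsign [set j]%SET K = 1 :> R.
Proof. by move=> /negbTE jK; rewrite exsign1 jK -expr2 sqrr_sign. Qed.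

Lemma exsign1_l j K L : exsign [set j]%SET K * exsign (j |: K)%SET L =
  exsign K L * exsign [set j]%SET (K :|: L)%SET.
Proof. exact: exsignA. Qed.

Lemma exsign1_r j K L : exsign [set j]%SET L * exsign K (j |: L)%SET =
  (-1) ^+ #|K| * (exsign [set j]%SET K * exsign (j |: K)%SET L).
Proof. by rewrite -exsignA exsignC cards1 muln1 setUC mulrA. Qed.

(** For xi_j common to both factors the product is 0, and so must be the sum of the
two terms given by the Leibniz rule. *)
Lemma exsign_both j K L : j \notin K -> j \notin L ->
  exsign K (j |: L)%SET * exsign [set j]%SET K +
  (-1) ^+ #|(j |: K)%SET| * exsign (j |: K)%SET L * exsign [set j]%SET L = 0 :> R.
Proof.
move=> jK jL; rewrite cardsU1 jK /=.
have := exsign1_r j K L; have := sqr_exsign1 jK; have := sqr_exsign1 jL.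
set a := exsign _ K; set b := exsign _ L; set X := exsign K _; set Y := exsign _ L.
move=> bb aa E; have -> : X = b * ((-1) ^+ #|K| * (a * Y)).
  by rewrite -E mulrA bb mul1r.
rewrite (_ : _ + _ = (a * a - 1) * (b * (-1) ^+ #|K| * Y)).
  by rewrite aa subrr mul0r.
by rewrite exprS; ring.
Qed.

Lemma setU1_inj j K L : j \notin K -> j \notin L ->
  (j |: K == j |: L)%SET = (K == L).
Proof.
move=> jK jL; apply/eqP/eqP => [e|->//].
by rewrite -(setU1K jK) e setU1K.
Qed.

(** The Leibniz rule for the left derivative by xi_j on the monomials xi^M and xi^K.
The cases are: j in both sets, in M only, in K only, in none. *)
Lemma exsign_leibniz j I M K :
  (M :|: K == j |: I)%SET%:R * (exsign [set j]%SET I * exsign M K) =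
  (j \in M)%:R * ((M :\ j :|: K == I)%SET%:R *
     (exsign (M :\ j)%SET K * exsign [set j]%SET (M :\ j)%SET)) +
  (j \in K)%:R * ((M :|: K :\ j == I)%SET%:R *
     ((-1) ^+ #|M| * exsign M (K :\ j)%SET * exsign [set j]%SET (K :\ j)%SET)) :> R.
Proof.
have eI0 : j \in I -> exsign [set j]%SET I = 0 :> R by move=> jI; rewrite exsign1 jI.
have [jM|jM] := boolP (j \in M); have [jK|jK] := boolP (j \in K);
  rewrite ?mul1r ?mul0r ?addr0 ?add0r.
- rewrite {1 2}/exsign (_ : [disjoint M & K] = false) ?mulr0; last first.
    by apply/negP => /disjointFr /(_ jM); rewrite jK.
  have eU : (M :|: K :\ j = M :\ j :|: K)%SET.
    by apply/setP => k; rewrite !inE; case: eqVneq => //= ->; rewrite jM jK.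
  rewrite eU -mulrDr -[X in X = _](mulr0 (M :\ j :|: K == I)%SET%:R); congr (_ * _).
  have := @exsign_both j (M :\ j)%SET (K :\ j)%SET.
  by rewrite !setD11 !setD1K // => ->.
- have jM' : j \notin (M :\ j)%SET by rewrite setD11.
  rewrite -{1 2}(setD1K jM); move: (M :\ j)%SET jM' => M' jM' {jM}.
  have [e|ne] := eqVneq (M' :|: K)%SET I; last first.
    rewrite mul0r; have [/eI0 ->|jI] := boolP (j \in I); first by rewrite mul0r mulr0.
    by rewrite -setUA setU1_inj ?(negbTE ne) ?mul0r // inE negb_or jM'.
  have jU : j \notin (M' :|: K)%SET by rewrite inE negb_or jM'.
  rewrite -e -setUA eqxx !mul1r.
  have := exsign1_l j M' K; have := sqr_exsign1 jM'; have := sqr_exsign1 jU.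
  set a := exsign _ M'; set c := exsign _ (M' :|: K)%SET; set Y := exsign _ K.
  move=> cc aa E; rewrite -[LHS]mul1r -[X in X * _ = _]aa.
  have -> : a * a * (c * Y) = c * a * (a * Y) by ring.
  by rewrite E -[RHS]mulr1 -[X in _ = _ * X]cc; ring.
- have jK' : j \notin (K :\ j)%SET by rewrite setD11.
  rewrite -{1 2}(setD1K jK); move: (K :\ j)%SET jK' => K' jK' {jK}.
  have [e|ne] := eqVneq (M :|: K')%SET I; last first.
    rewrite mul0r; have [/eI0 ->|jI] := boolP (j \in I); first by rewrite mul0r mulr0.
    by rewrite setUCA setU1_inj ?(negbTE ne) ?mul0r // inE negb_or jM.
  have jU : j \notin (M :|: K')%SET by rewrite inE negb_or jM.
  rewrite -e setUCA eqxx !mul1r.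
  have := exsign1_r j M K'; rewrite exsign1_l; have := sqr_exsign1 jK'; have := sqr_exsign1 jU.
  set b := exsign _ K'; set c := exsign _ (M :|: K')%SET; set X := exsign M _.
  move=> cc bb E; rewrite -[LHS]mul1r -[X in X * _ = _]bb.
  have -> : b * b * (c * X) = c * b * (b * X) by ring.
  by rewrite E -[RHS]mulr1 -[X in _ = _ * X]cc; ring.
rewrite (_ : _ == _ = false) ?mul0r //; apply/eqP/setP => /(_ j).
by rewrite !inE eqxx (negbTE jM) (negbTE jK).
Qed.

(** The substitution M = j |: J, under which the sets J without j correspond to the
sets M with j. *)
Lemma sum_exsign1 j (h : {set 'I_m} -> R) (f : {set 'I_m} -> R) :
  \sum_J h J * (exsign [set j]%SET J * f (j |: J)%SET) =
  \sum_(M : {set 'I_m}) (j \in M)%:R * (h (M :\ j)%SET * exsign [set j]%SET (M :\ j)%SET * f M).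
Proof.
rewrite (bigID (fun J : {set 'I_m} => j \in J)) /= big1 ?add0r => [|J jJ]; last first.
  by rewrite exsign1 jJ mul0r mulr0.
rewrite (reindex_onto (fun M : {set 'I_m} => M :\ j)%SET (fun J => j |: J)%SET) /=; last first.
  by move=> J jJ; rewrite setU1K.
rewrite big_mkcond; apply: eq_bigr => M _; rewrite setD11 /=.
case: (boolP (j \in M)) => jM; first by rewrite setD1K // eqxx mul1r mulrA.
rewrite ifF ?mul0r //; apply/eqP => e; move: jM; rewrite -e.
by rewrite !inE eqxx.
Qed.

Lemma pd_oddM j F G I x :
  pd (inr j) (smul F G) I x =
  smul (pd (inr j) F) G I x + smul (stwist true F) (pd (inr j) G) I x.
Proof.
transitivity (\sum_M \sum_K (M :|: K == j |: I)%SET%:R *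
   (exsign [set j]%SET I * exsign M K) * (F M x * G K x)).
  rewrite pd_oddE smulE mulr_sumr; apply: eq_bigr => M _.
  by rewrite mulr_sumr; apply: eq_bigr => K _; ring.
under eq_bigr => M _.
  under eq_bigr => K _ do rewrite exsign_leibniz mulrDl.
  rewrite big_split /=; over.
rewrite big_split /=; congr (_ + _).
  rewrite smulE exchange_big [RHS]exchange_big; apply: eq_bigr => K _.
  transitivity (\sum_J (J :|: K == I)%SET%:R * exsign J K * G K x *
     (exsign [set j]%SET J * F (j |: J)%SET x)).
    rewrite (sum_exsign1 j (fun J => (J :|: K == I)%SET%:R * exsign J K * G K x)
       (fun M => F M x)).
    by apply: eq_bigr => M _; ring.
  by apply: eq_bigr => J _; rewrite pd_oddE; ring.
rewrite smulE; apply: eq_bigr => M _.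
transitivity (\sum_K (M :|: K == I)%SET%:R * ((-1) ^+ #|M| * exsign M K) * F M x *
     (exsign [set j]%SET K * G (j |: K)%SET x)).
  rewrite (sum_exsign1 j (fun K => (M :|: K == I)%SET%:R * ((-1) ^+ #|M| * exsign M K) * F M x)
       (fun K => G K x)).
  by apply: eq_bigr => K _; ring.
by apply: eq_bigr => K _; rewrite pd_oddE /stwist mul1n; ring.
Qed.

End Exterior.

(** * The ring of superfunctions on an open set *)

(** Bundled with openness, so that the ring below can be attached to the open set as
a type. *)
Record opens (R : realType) (n : nat) := Opens {
  oset :> set 'rV[R]_n; oset_open : open oset }.

(** Functions vanish outside W: then functions that agree on W are equal, and the
identities valid on W become equalities in a ring. *)
Record superfun (R : realType) (n m : nat) (W : opens R n) := Superfun {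
  sfval :> sfun R n m;
  sf_smooth : ssmooth_on W sfval;
  sf_supp : forall I x, ~ oset W x -> sfval I x = 0 }.

Section SuperfunRing.
Local Open Scope classical_set_scope.
Context {R : realType} {n m : nat} {W : opens R n}.
Local Notation P := (superfun m W).
Implicit Types (X Y Z : P) (F G : sfun R n m) (I : {set 'I_m}) (p q : bool) (j k : ix n m).

Let oW : open W := @oset_open R n W.

Lemma superfun_ext X Y : eq_on W X Y -> X = Y.
Proof.
case: X Y => F sF zF [G sG zG] /= FG.
have E : F = G.
  apply/funext => I; apply/funext => x; have [/FG -> //|nW] := pselect (oset W x).
  by rewrite zF // zG.
by case: _ / E in sG zG FG *; congr Superfun; exact: Prop_irrelevance.
Qed.

Lemma ssmooth_eq F G : eq_on W F G -> ssmooth_on W F -> ssmooth_on W G.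
Proof. by move=> FG sF I; apply: (smooth_eq oW (FG I)); exact: sF. Qed.

Definition cut F : sfun R n m := fun I x => if `[< oset W x >] then F I x else 0.

Lemma cutE F : eq_on W (cut F) F.
Proof. by move=> I x Wx; rewrite /cut asboolT. Qed.

Fact cut_smooth F : ssmooth_on W F -> ssmooth_on W (cut F).
Proof. by apply: ssmooth_eq => I x Wx; rewrite cutE. Qed.

Fact cut_supp F I x : ~ oset W x -> cut F I x = 0.
Proof. by move=> nW; rewrite /cut asboolF. Qed.

Definition mk_superfun F (sF : ssmooth_on W F) : P :=
  Superfun (cut_smooth sF) (@cut_supp F).

(** Concrete functions are compared with elements of the ring through this relation,
which every operation preserves; an equality between the two sides would fail
outside W. *)
Definition rep X F := eq_on W X F.

Lemma rep_mk F (sF : ssmooth_on W F) : rep (mk_superfun sF) F.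
Proof. exact: cutE. Qed.

Lemma rep_self X : rep X X. Proof. by []. Qed.

Lemma rep_inj X Y F : rep X F -> rep Y F -> X = Y.
Proof. by move=> XF YF; apply: superfun_ext => I x Wx; rewrite XF // YF. Qed.

Lemma ssmooth_sconst c : ssmooth_on W (sconst c : sfun R n m).
Proof. by move=> I; rewrite /sconst; case: eqP => _; exact: smooth_cst. Qed.

Lemma ssmooth_add F G : ssmooth_on W F -> ssmooth_on W G -> ssmooth_on W (F + G).
Proof. by move=> sF sG I; apply: smoothD (sF I) (sG I); exact: oW. Qed.

Lemma ssmooth_scale c F : ssmooth_on W F -> ssmooth_on W (sscale c F).
Proof. by move=> sF I; apply: smoothM (sF I); [|apply: smooth_cst]; exact: oW. Qed.

Lemma ssmooth_opp F : ssmooth_on W F -> ssmooth_on W (- F).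
Proof.
move=> /(@ssmooth_scale (-1)); apply: ssmooth_eq => I x _.
by rewrite /sscale mulN1r.
Qed.

Lemma ssmooth_mul F G : ssmooth_on W F -> ssmooth_on W G -> ssmooth_on W (smul F G).
Proof.
move=> sF sG I; apply: smooth_sum => [|J]; first exact: oW.
apply: smoothM; [exact: oW | apply: smooth_cst; exact: oW |].
by apply: smoothM (sF _) (sG _); exact: oW.
Qed.

Lemma ssmooth_twist p F : ssmooth_on W F -> ssmooth_on W (stwist p F).
Proof. by move=> sF I; apply: smoothM (sF I); [|apply: smooth_cst]; exact: oW. Qed.

Lemma ssmooth_pd j F : ssmooth_on W F -> ssmooth_on W (pd j F).
Proof.
move=> sF I; case: j => [i|k] /=; first exact: smooth_partial.
rewrite /pd; case: (k \in I); first by apply: smooth_cst; exact: oW.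
by apply: smoothM (sF _); [|apply: smooth_cst]; exact: oW.
Qed.

Lemma ssmooth_coord j : ssmooth_on W (scoord j : sfun R n m).
Proof.
move=> I; case: j => [i|k] /=; last by apply: smooth_cst; exact: oW.
rewrite /scoord; case: eqP => _; [apply: smooth_coord | apply: smooth_cst]; exact: oW.
Qed.

Definition sf_cst c : P := mk_superfun (ssmooth_sconst c).
Definition sf_add X Y : P := mk_superfun (ssmooth_add (sf_smooth X) (sf_smooth Y)).
Definition sf_opp X : P := mk_superfun (ssmooth_opp (sf_smooth X)).
Definition sf_mul X Y : P := mk_superfun (ssmooth_mul (sf_smooth X) (sf_smooth Y)).
Definition sf_tau X : P := mk_superfun (ssmooth_twist true (sf_smooth X)).
Definition sf_der j X : P := mk_superfun (ssmooth_pd j (sf_smooth X)).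
Definition sf_coord j : P := mk_superfun (ssmooth_coord j).

Lemma rep_add X Y F G : rep X F -> rep Y G -> rep (sf_add X Y) (F + G).
Proof. by move=> XF YG I x Wx; rewrite rep_mk // -[LHS]/(X I x + Y I x) XF // YG. Qed.

Lemma rep_opp X F : rep X F -> rep (sf_opp X) (- F).
Proof. by move=> XF I x Wx; rewrite rep_mk // -[LHS]/(- X I x) XF. Qed.

Lemma rep_mul X Y F G : rep X F -> rep Y G -> rep (sf_mul X Y) (smul F G).
Proof.
move=> XF YG I x Wx; rewrite rep_mk //.
by apply: smul_ext => J; [exact: XF | exact: YG].
Qed.

Lemma sf_addA : associative sf_add.
Proof.
move=> X Y Z; apply: (rep_inj (rep_add (rep_self X) (rep_add (rep_self Y) (rep_self Z)))).
rewrite addrA; exact: (rep_add (rep_add (rep_self X) (rep_self Y)) (rep_self Z)).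
Qed.

Lemma sf_addC : commutative sf_add.
Proof.
move=> X Y; apply: (rep_inj (rep_add (rep_self X) (rep_self Y))).
rewrite addrC; exact: (rep_add (rep_self Y) (rep_self X)).
Qed.

Lemma rep_zero : rep (sf_cst 0) 0.
Proof. by move=> I x Wx; rewrite rep_mk // /sconst if_same. Qed.

Lemma sf_add0 : left_id (sf_cst 0) sf_add.
Proof.
move=> X; apply: (rep_inj (rep_add rep_zero (rep_self X))); rewrite add0r.
exact: rep_self.
Qed.

Lemma sf_addN : left_inverse (sf_cst 0) sf_opp sf_add.
Proof.
move=> X; apply: (rep_inj (rep_add (rep_opp (rep_self X)) (rep_self X))).
by rewrite addNr; exact: rep_zero.
Qed.

HB.instance Definition _ := gen_eqMixin P.
HB.instance Definition _ := gen_choiceMixin P.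
HB.instance Definition _ := GRing.isZmodule.Build P sf_addA sf_addC sf_add0 sf_addN.

Lemma sf_mulA : associative sf_mul.
Proof.
move=> X Y Z; apply: superfun_ext => I x Wx.
rewrite (rep_mul (rep_self X) (rep_mul (rep_self Y) (rep_self Z))) //.
by rewrite (rep_mul (rep_mul (rep_self X) (rep_self Y)) (rep_self Z)) // smulA.
Qed.

Lemma sf_mul1l : left_id (sf_cst 1) sf_mul.
Proof.
move=> X; apply: superfun_ext => I x Wx.
by rewrite (rep_mul (rep_mk (ssmooth_sconst 1)) (rep_self X)) // smul1l.
Qed.

Lemma sf_mul1r : right_id (sf_cst 1) sf_mul.
Proof.
move=> X; apply: superfun_ext => I x Wx.
by rewrite (rep_mul (rep_self X) (rep_mk (ssmooth_sconst 1))) // smul1r.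
Qed.

Lemma sf_mulDl : left_distributive sf_mul sf_add.
Proof.
move=> X Y Z; apply: superfun_ext => I x Wx.
rewrite (rep_mul (rep_add (rep_self X) (rep_self Y)) (rep_self Z)) // smulDl.
by rewrite (rep_add (rep_mul (rep_self X) (rep_self Z)) (rep_mul (rep_self Y) (rep_self Z))).
Qed.

Lemma sf_mulDr : right_distributive sf_mul sf_add.
Proof.
move=> X Y Z; apply: superfun_ext => I x Wx.
rewrite (rep_mul (rep_self X) (rep_add (rep_self Y) (rep_self Z))) // smulDr.
by rewrite (rep_add (rep_mul (rep_self X) (rep_self Y)) (rep_mul (rep_self X) (rep_self Z))).
Qed.

HB.instance Definition _ := GRing.Zmodule_isPzRing.Build P
  sf_mulA sf_mul1l sf_mul1r sf_mulDl sf_mulDr.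

Lemma rep0 : rep 0 0. Proof. exact: rep_zero. Qed.
Lemma rep1 : rep 1 (sconst 1). Proof. exact: rep_mk. Qed.
Lemma repD X Y F G : rep X F -> rep Y G -> rep (X + Y) (F + G).
Proof. exact: rep_add. Qed.
Lemma repN X F : rep X F -> rep (- X) (- F). Proof. exact: rep_opp. Qed.
Lemma repM X Y F G : rep X F -> rep Y G -> rep (X * Y) (smul F G).
Proof. exact: rep_mul. Qed.
Lemma repB X Y F G : rep X F -> rep Y G -> rep (X - Y) (F - G).
Proof. by move=> XF YG; apply: repD => //; apply: repN. Qed.

Lemma rep_sum (J : finType) (X : J -> P) (F : J -> sfun R n m) :
  (forall i, rep (X i) (F i)) -> rep (\sum_i X i) (\sum_i F i).
Proof. by move=> h; elim/big_rec2: _ => [|i G Y _ YG]; [exact: rep0 | exact: repD]. Qed.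

Lemma rep_sign p X F : rep X F -> rep ((-1) ^+ p * X) (sscale ((-1) ^+ p) F).
Proof.
move=> XF; case: p => I x Wx.
  by rewrite mulN1r /sscale mulN1r -[RHS]/((- F) I x); apply: (repN XF).
by rewrite mul1r /sscale mul1r; apply: XF.
Qed.

Lemma rep_mulrn (k : nat) X F : rep X F -> rep (X *+ k) (sscale k%:R F).
Proof.
move=> XF; elim: k => [|k IH] I x Wx.
  by rewrite /sscale mul0r; apply: rep0.
by rewrite mulrS (repD XF IH) // -[LHS]/(F I x + k%:R * F I x) /sscale mulrS mulrDl mul1r.
Qed.

Lemma pd_ext j F G : eq_on W F G -> eq_on W (pd j F) (pd j G).
Proof.
move=> FG I x Wx; case: j => [i|k] /=; last by rewrite FG.
exact: (partial_eq i oW Wx (FG I)).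
Qed.

Lemma rep_der j X F : rep X F -> rep (sf_der j X) (pd j F).
Proof. by move=> XF I x Wx; rewrite rep_mk //; apply: pd_ext. Qed.

Lemma rep_tau X F : rep X F -> rep (sf_tau X) (stwist true F).
Proof. by move=> XF I x Wx; rewrite rep_mk // /stwist XF. Qed.

Lemma sf_torsion (k : nat) X : X *+ k.+1 = 0 -> X = 0.
Proof.
move=> h; apply: (rep_inj _ rep0) => I x Wx.
have := rep_mulrn k.+1 (rep_self X) I Wx; rewrite h.
rewrite rep0 // /sscale => /esym/eqP; rewrite mulf_eq0 pnatr_eq0 /= => /eqP.
by [].
Qed.

Lemma sf_tauK : involutive sf_tau.
Proof.
move=> X; apply: superfun_ext => I x Wx.
by rewrite (rep_tau (rep_tau (rep_self X))) // stwistK.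
Qed.

Fact sf_tau_zmod : zmod_morphism sf_tau.
Proof.
move=> X Y; apply: superfun_ext => I x Wx.
rewrite (rep_tau (repB (rep_self X) (rep_self Y))) //.
by rewrite (repB (rep_tau (rep_self X)) (rep_tau (rep_self Y))) // /stwist mulrBr.
Qed.

Fact sf_tau_monoid : monoid_morphism sf_tau.
Proof.
split=> [|X Y]; apply: superfun_ext => I x Wx.
  rewrite (rep_tau rep1) // rep1 // /stwist /sconst; case: eqP => [->|_].
    by rewrite cards0 muln0 expr0 mul1r.
  by rewrite mulr0.
rewrite (rep_tau (repM (rep_self X) (rep_self Y))) // stwistM.
by rewrite (repM (rep_tau (rep_self X)) (rep_tau (rep_self Y))).
Qed.

HB.instance Definition _ := GRing.isZmodMorphism.Build P P sf_tau sf_tau_zmod.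
HB.instance Definition _ := GRing.isMonoidMorphism.Build P P sf_tau sf_tau_monoid.

(** In characteristic 0 the eigenvalue of the parity involution determines the
parity. *)
Lemma parity_vanish p X : sf_tau X = (-1) ^+ p * X ->
  forall I x, oset W x -> odd #|I| != p -> X I x = 0.
Proof.
move=> h I x Wx Ip; have := rep_tau (rep_self X) I Wx; rewrite h.
rewrite (rep_sign p (rep_self X)) // /sscale /stwist mul1n -(signr_odd _ #|I|) => /eqP.
move: Ip; case: p {h}; case: odd => //= _; rewrite ?expr0 ?expr1 ?mulN1r ?mul1r.
  by rewrite eq_sym -addr_eq0 -mulr2n mulrn_eq0 => /eqP.
by rewrite -addr_eq0 -mulr2n mulrn_eq0 => /eqP.
Qed.

Lemma sf_comm p q X Y : sf_tau X = (-1) ^+ p * X -> sf_tau Y = (-1) ^+ q * Y ->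
  X * Y = (-1) ^+ (p && q) * (Y * X).
Proof.
move=> hX hY; apply: superfun_ext => I x Wx.
rewrite (repM (rep_self X) (rep_self Y)) //.
rewrite (rep_sign _ (repM (rep_self Y) (rep_self X))) // /sscale.
by apply: smulC => J; [apply: parity_vanish hX _ _ Wx | apply: parity_vanish hY _ _ Wx].
Qed.

End SuperfunRing.

(** * Differential operators and their symbols *)

(** The rules of calculus for superfunctions on a cotangent bundle: coordinates xx
and momenta pp indexed by I, with derivations dx and dp, and the parity involution
tau.  An element of parity p is one on which tau is (-1)^p, so that homogeneity
needs no separate predicate. *)
Record supercalculus (I : finType) (par : I -> bool) := Supercalculus {
  sc_ring :> pzRingType;
  tau : {rmorphism sc_ring -> sc_ring};
  dx : I -> {additive sc_ring -> sc_ring};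
  dp : I -> {additive sc_ring -> sc_ring};
  xx : I -> sc_ring;
  pp : I -> sc_ring;
  sc_torsion : forall n (X : sc_ring), X *+ n.+1 = 0 -> X = 0;
  tauK : involutive tau;
  sc_comm : forall (p q : bool) (X Y : sc_ring),
    tau X = (-1) ^+ p * X -> tau Y = (-1) ^+ q * Y ->
    X * Y = (-1) ^+ (p && q) * (Y * X);
  tau_dx : forall a X, tau (dx a X) = (-1) ^+ par a * dx a (tau X);
  tau_dp : forall a X, tau (dp a X) = (-1) ^+ par a * dp a (tau X);
  dxM : forall a X Y,
    dx a (X * Y) = dx a X * Y + (if par a then tau X else X) * dx a Y;
  dpM : forall a X Y,
    dp a (X * Y) = dp a X * Y + (if par a then tau X else X) * dp a Y;
  dxC : forall a b X,
    dx a (dx b X) = (-1) ^+ (par a && par b) * dx b (dx a X);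
  dpC : forall a b X,
    dp a (dp b X) = (-1) ^+ (par a && par b) * dp b (dp a X);
  dpdx : forall a b X,
    dp a (dx b X) = (-1) ^+ (par a && par b) * dx b (dp a X);
  tau_xx : forall a, tau (xx a) = (-1) ^+ par a * xx a;
  tau_pp : forall a, tau (pp a) = (-1) ^+ par a * pp a;
  dx_xx : forall a b, dx a (xx b) = (a == b)%:R;
  dx_pp : forall a b, dx a (pp b) = 0;
  dp_pp : forall a b, dp a (pp b) = (a == b)%:R
}.

Arguments tau {I par s}.
Arguments dx {I par s}.
Arguments dp {I par s}.
Arguments xx {I par s}.
Arguments pp {I par s}.

Section Calculus.
Context {I : finType} {par : I -> bool} {P : supercalculus par}.
Implicit Types (X Y F G : P) (a b c d : I) (p q r : bool).

(** The sign that appears when something of parity p moves past X, whether or not X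
is homogeneous. *)
Definition twist p X := if p then tau X else X.
Definition has_parity p X := tau X = (-1) ^+ p * X.

(** Signs are kept in front of a product as powers of -1, where sign2 merges them; an
equality of signs is then a tautology about booleans. *)
Lemma signM p X Y : X * ((-1) ^+ p * Y) = (-1) ^+ p * (X * Y).
Proof. by rewrite mulrA commr_sign mulrA. Qed.

Lemma sign2 p q X : (-1) ^+ p * ((-1) ^+ q * X) = (-1) ^+ (p (+) q) * X.
Proof. by rewrite mulrA signr_addb. Qed.

Lemma signE p q X : p = q -> (-1) ^+ p * X = (-1) ^+ q * X.
Proof. by move->. Qed.

Lemma twist_parity p q X : has_parity q X -> twist p X = (-1) ^+ (p && q) * X.
Proof. by case: p => // _; rewrite mul1r. Qed.

Lemma supercommute p q X Y : has_parity p X -> has_parity q Y -> X * Y = (-1) ^+ (p && q) * (Y * X).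
Proof. exact: sc_comm. Qed.

Lemma has_parityM p q X Y : has_parity p X -> has_parity q Y -> has_parity (p (+) q) (X * Y).
Proof. by rewrite /has_parity rmorphM => -> ->; rewrite signM mulrA sign2 addbC mulrA. Qed.

Lemma has_parityD p X Y : has_parity p X -> has_parity p Y -> has_parity p (X + Y).
Proof. by rewrite /has_parity rmorphD mulrDr => -> ->. Qed.

Lemma has_parityB p X Y : has_parity p X -> has_parity p Y -> has_parity p (X - Y).
Proof. by rewrite /has_parity rmorphB mulrBr => -> ->. Qed.

Lemma has_parity_sum (J : finType) p (F : J -> P) :
  (forall j, has_parity p (F j)) -> has_parity p (\sum_j F j).
Proof.
by move=> h; rewrite /has_parity rmorph_sum mulr_sumr; apply: eq_bigr => j _; exact: h.
Qed.

Lemma has_parity_dx p a X : has_parity p X -> has_parity (par a (+) p) (dx a X).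
Proof. by rewrite /has_parity tau_dx => ->; rewrite raddfMsign sign2. Qed.

Lemma has_parity_dp p a X : has_parity p X -> has_parity (par a (+) p) (dp a X).
Proof. by rewrite /has_parity tau_dp => ->; rewrite raddfMsign sign2. Qed.

Lemma has_parity_pp a : has_parity (par a) (pp a : P). Proof. exact: tau_pp. Qed.

Lemma dxMh p a X Y : has_parity p X ->
  dx a (X * Y) = dx a X * Y + (-1) ^+ (par a && p) * (X * dx a Y).
Proof. by rewrite dxM -/(twist _ _) => /twist_parity ->; rewrite mulrA. Qed.

Lemma dpMh p a X Y : has_parity p X ->
  dp a (X * Y) = dp a X * Y + (-1) ^+ (par a && p) * (X * dp a Y).
Proof. by rewrite dpM -/(twist _ _) => /twist_parity ->; rewrite mulrA. Qed.

Lemma twistM p X Y : twist p (X * Y) = twist p X * twist p Y.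
Proof. by case: p; rewrite /twist ?rmorphM. Qed.

Lemma twistD p X Y : twist p (X + Y) = twist p X + twist p Y.
Proof. by case: p; rewrite /twist ?rmorphD. Qed.

Lemma twist_sum (J : finType) p (F : J -> P) : twist p (\sum_j F j) = \sum_j twist p (F j).
Proof. by case: p; rewrite /twist ?rmorph_sum. Qed.

Lemma twistK p : involutive (twist p). Proof. by case: p => // X; rewrite /twist tauK. Qed.

Lemma dp_twist a p X : dp a (twist p X) = (-1) ^+ (p && par a) * twist p (dp a X).
Proof. by case: p; rewrite /twist ?mul1r // tau_dp sign2 addbb mul1r. Qed.

Lemma dx_twist a p X : dx a (twist p X) = (-1) ^+ (p && par a) * twist p (dx a X).
Proof. by case: p; rewrite /twist ?mul1r // tau_dx sign2 addbb mul1r. Qed.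

(** The derivative by the momentum p_a acting from the right: it commutes with left
multiplication by functions of the coordinates (rdp_pfreeM), which keeps the
coefficients of a polynomial in the momenta free of signs. *)
Definition rdp a X := (-1) ^+ par a * dp a (twist (par a) X).

Lemma rdp_sum (J : finType) a (F : J -> P) : rdp a (\sum_j F j) = \sum_j rdp a (F j).
Proof. by rewrite /rdp twist_sum raddf_sum mulr_sumr. Qed.

Lemma rdp0 a : rdp a 0 = 0.
Proof. by rewrite /rdp /twist; case: ifP; rewrite ?rmorph0 raddf0 mulr0. Qed.

Lemma rdp_odd a X : has_parity true X -> rdp a X = dp a X.
Proof.
by move=> h; rewrite /rdp (twist_parity _ h) raddfMsign sign2 andbT addbb mul1r.
Qed.

(** Functions of the coordinates only. *)
Definition pfree X := forall a, dp a X = 0.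

Lemma pfree1 : pfree 1.
Proof.
move=> a; apply: (addrI (dp a 1)); rewrite addr0.
by rewrite -[in RHS](mulr1 1) dpM rmorph1 if_same mulr1 mul1r.
Qed.

Lemma pfree_sign p X : pfree X -> pfree ((-1) ^+ p * X).
Proof. by move=> h a; rewrite raddfMsign h mulr0. Qed.

Lemma pfreeD X Y : pfree X -> pfree Y -> pfree (X + Y).
Proof. by move=> h1 h2 a; rewrite raddfD h1 h2 addr0. Qed.

Lemma pfree_sum (J : finType) (F : J -> P) : (forall j, pfree (F j)) -> pfree (\sum_j F j).
Proof. by move=> h a; rewrite raddf_sum big1 // => j _; rewrite h. Qed.

Lemma pfreeM X Y : pfree X -> pfree Y -> pfree (X * Y).
Proof. by move=> h1 h2 a; rewrite dpM h1 h2 mulr0 mul0r addr0. Qed.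

Lemma pfree_dx a X : pfree X -> pfree (dx a X).
Proof. by move=> h b; rewrite dpdx h raddf0 mulr0. Qed.

Lemma pfree_twist p X : pfree X -> pfree (twist p X).
Proof. by move=> h a; rewrite dp_twist h /twist; case: p; rewrite ?raddf0 mulr0. Qed.

Lemma rdp_pfreeM a X Y : pfree X -> rdp a (X * Y) = X * rdp a Y.
Proof.
move=> h; rewrite /rdp twistM dpM (pfree_twist _ h) mul0r add0r -/(twist _ _) twistK.
by rewrite signM.
Qed.

Lemma rdpMpp a b Y :
  rdp a (Y * pp b) = (a == b)%:R * Y + (-1) ^+ (par a && par b) * (rdp a Y * pp b).
Proof.
rewrite /rdp twistM dpM -/(twist _ _) twistK mulrDr addrC; congr (_ + _).
  rewrite (twist_parity _ (has_parity_pp b)) raddfMsign dp_pp signM sign2.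
  by case: eqVneq => [->|_]; rewrite ?andbb ?addbb ?mul1r ?mulr1 // !mul0r !mulr0.
rewrite (twist_parity _ (has_parity_pp b)) (signM _ (dp a _)) -[in RHS]mulrA.
by rewrite [LHS]sign2 [RHS]sign2 addbC.
Qed.

Lemma rdp_pp a b : rdp a (pp b) = (a == b)%:R :> P.
Proof.
rewrite -[pp b]mul1r rdpMpp -[1]mulr1 rdp_pfreeM; last first.
  by exact: pfree1.
suff -> : rdp a 1 = 0 by rewrite mulr0 mul0r mulr0 addr0 !mulr1.
by rewrite /rdp /twist; case: (par a); rewrite ?rmorph1 pfree1 mulr0.
Qed.

(** A coefficient C with indices a, b, c yields both the operator op3, in which the
derivative by x^a acts first, and the polynomial symb3, in which p_a is the
rightmost factor: replacing derivatives by momenta preserves the order. *)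
Definition symb1 (C : I -> P) := \sum_a C a * pp a.
Definition op1 (C : I -> P) G := \sum_a C a * dx a G.
Definition symb2 (C : I -> I -> P) := \sum_a \sum_b C a b * (pp b * pp a).
Definition op2 (C : I -> I -> P) G := \sum_a \sum_b C a b * dx b (dx a G).
Definition symb3 (C : I -> I -> I -> P) :=
  \sum_a \sum_b \sum_c C a b c * (pp c * (pp b * pp a)).
Definition op3 (C : I -> I -> I -> P) G :=
  \sum_a \sum_b \sum_c C a b c * dx c (dx b (dx a G)).

Lemma op2Dl (C D : I -> I -> P) G :
  op2 (fun b c => C b c + D b c) G = op2 C G + op2 D G.
Proof.
rewrite /op2 -big_split; apply: eq_bigr => a _; rewrite -big_split.
by apply: eq_bigr => b _; rewrite mulrDl.
Qed.

Lemma torsion2 X : X + X = 0 -> X = 0.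
Proof. by rewrite -mulr2n => /sc_torsion. Qed.

(** The mechanism of the cancellations: a double sum that changes sign when the
indices are exchanged is zero, the ring having no 2-torsion. *)
Lemma sum_anti (J : finType) (t : J -> J -> P) :
  (forall i j, t i j = - t j i) -> \sum_i \sum_j t i j = 0.
Proof.
move=> h; apply: torsion2; rewrite {2}exchange_big /= -big_split big1 //= => i _.
by rewrite -big_split big1 //= => j _; rewrite [t j i]h subrr.
Qed.

Lemma sum_delta (F : I -> P) a : \sum_b (a == b)%:R * F b = F a.
Proof.
rewrite (bigD1 a) //= eqxx mul1r big1 ?addr0 // => b /negbTE.
by rewrite eq_sym => ->; rewrite mul0r.
Qed.

Lemma rdp_symb1 C a : (forall b, pfree (C b)) -> rdp a (symb1 C) = C a.
Proof.
move=> hC; rewrite /symb1 rdp_sum -[RHS](sum_delta C); apply: eq_bigr => b _.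
by rewrite rdp_pfreeM // rdp_pp; case: eqP; rewrite ?mulr0 ?mul0r ?mulr1 ?mul1r.
Qed.

Lemma rdp_mul_pp2 a b c X : pfree X ->
  rdp a (X * (pp c * pp b)) = (a == b)%:R * (X * pp c) +
    (a == c)%:R * ((-1) ^+ (par a && par b) * (X * pp b)).
Proof.
move=> hX; rewrite rdp_pfreeM // rdpMpp rdp_pp mulrDr.
by do 2![case: eqP => _]; rewrite ?(mul1r, mul0r, mulr0, addr0, add0r) // signM.
Qed.

Lemma rdp_mul_pp3 a b c d X : pfree X ->
  rdp a (X * (pp d * (pp c * pp b))) = (a == b)%:R * (X * (pp d * pp c)) +
    (a == c)%:R * ((-1) ^+ (par a && par b) * (X * (pp d * pp b))) +
    (a == d)%:R * ((-1) ^+ ((par a && par b) (+) (par a && par c)) *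
       (X * (pp c * pp b))).
Proof.
move=> hX; rewrite rdp_pfreeM // (mulrA (pp d)) rdpMpp rdpMpp rdp_pp.
rewrite mulrDl 2!mulrDr (mulrDr X) addrA; congr (_ + _ + _).
- by case: eqP => _; rewrite ?(mul1r, mul0r, mulr0).
- by case: eqP => _; rewrite ?(mul1r, mul0r, mulr0) // signM.
case: eqP => _; rewrite ?(mul1r, mul0r, mulr0) // ?mulr1.
by rewrite -mulrA [X in X = _]signM (signM _ X) sign2.
Qed.

Lemma rdp_symb2 C a : (forall b c, pfree (C b c)) ->
  rdp a (symb2 C) = symb1 (fun b => C a b + (-1) ^+ (par a && par b) * C b a).
Proof.
move=> hC; rewrite /symb2 rdp_sum /symb1.
under eq_bigr => b _.
  rewrite rdp_sum; under eq_bigr => c _ do rewrite rdp_mul_pp2 //.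
  rewrite big_split /= -mulr_sumr sum_delta; over.
rewrite big_split /= sum_delta -big_split /=.
by apply: eq_bigr => b _; rewrite mulrDl mulrA.
Qed.

Lemma sym_op2 C G :
  (forall a b, C a b + (-1) ^+ (par a && par b) * C b a = 0) -> op2 C G = 0.
Proof.
move=> h; apply: torsion2; rewrite /op2 {2}exchange_big /= -big_split big1 //= => a _.
rewrite -big_split big1 //= => b _.
by rewrite (dxC a b) (signM _ (C b a)) [X in _ + X]mulrA -mulrDl h mul0r.
Qed.

Lemma sym_symb2 C :
  (forall a b, C a b + (-1) ^+ (par a && par b) * C b a = 0) -> symb2 C = 0.
Proof.
move=> h; apply: torsion2; rewrite /symb2 {2}exchange_big /= -big_split big1 //= => a _.
rewrite -big_split big1 //= => b _.
rewrite (supercommute (has_parity_pp a) (has_parity_pp b)) (signM _ (C b a)).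
rewrite [X in _ + X]mulrA -mulrDl h.
by rewrite mul0r.
Qed.

(** The second derivatives of a quadratic form in the momenta are its symmetrized
coefficients. *)
Lemma symb2_sym C : (forall b c, pfree (C b c)) -> symb2 C = 0 ->
  forall a b, C a b + (-1) ^+ (par a && par b) * C b a = 0.
Proof.
move=> hC h a b; have := congr1 (rdp b) (congr1 (rdp a) h).
rewrite !rdp0 rdp_symb2 // rdp_symb1 // => c; apply: pfreeD => //; exact: pfree_sign.
Qed.

Lemma symb2_op2 C G : (forall b c, pfree (C b c)) -> symb2 C = 0 -> op2 C G = 0.
Proof. by move=> hC h; apply: sym_op2; apply: symb2_sym. Qed.

Lemma rdp_symb3 C a : (forall b c d, pfree (C b c d)) ->
  rdp a (symb3 C) = symb2 (fun b c => C a b c + (-1) ^+ (par a && par b) * C b a c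
     + (-1) ^+ ((par a && par b) (+) (par a && par c)) * C b c a).
Proof.
move=> hC; rewrite /symb3 rdp_sum /symb2.
under eq_bigr => b _.
  rewrite rdp_sum.
  under eq_bigr => c _.
    rewrite rdp_sum; under eq_bigr => d _ do rewrite rdp_mul_pp3 //.
    rewrite !big_split /= sum_delta -!mulr_sumr; over.
  rewrite !big_split /= -mulr_sumr sum_delta; over.
rewrite !big_split /= sum_delta -!big_split /=.
apply: eq_bigr => b _; rewrite mulr_sumr -!big_split /=; apply: eq_bigr => c _.
by rewrite !mulrDl !mulrA.
Qed.

(** Differentiating the cubic symbol once gives quadratic symbols, whose operators
are zero by symb2_op2; by the symmetry of the derivatives, composing them with
the first derivatives and summing gives three times the cubic operator. *)
Lemma symb3_op3 C G : (forall b c d, pfree (C b c d)) -> symb3 C = 0 -> op3 C G = 0.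
Proof.
move=> hC h; suff : op3 C G *+ 3 = 0 by exact: sc_torsion.
have h2 a : op2 (fun b c => C a b c + (-1) ^+ (par a && par b) * C b a c
     + (-1) ^+ ((par a && par b) (+) (par a && par c)) * C b c a) (dx a G) = 0.
  apply: symb2_op2; last by rewrite -rdp_symb3 // h rdp0.
  by move=> b c; apply: pfreeD; [apply: pfreeD|] => //; apply: pfree_sign.
have : \sum_a (op2 (C a) (dx a G) +
     op2 (fun b c => (-1) ^+ (par a && par b) * C b a c) (dx a G) +
     op2 (fun b c => (-1) ^+ ((par a && par b) (+) (par a && par c)) * C b c a)
       (dx a G)) = 0.
  by rewrite big1 // => a _; rewrite -!op2Dl h2.
rewrite !big_split /= => e; rewrite -[RHS]e !mulrS mulr0n addr0 addrA.
congr (_ + _ + _).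
  rewrite /op3 exchange_big /=; apply: eq_bigr => b _; apply: eq_bigr => a _.
  apply: eq_bigr => c _.
  by rewrite (dxC b a) raddfMsign (signM _ (C a b c)) mulrA andbC.
rewrite /op3.
rewrite [RHS]exchange_big /=; apply: eq_bigr => b _.
rewrite [RHS]exchange_big /=; apply: eq_bigr => c _; apply: eq_bigr => a _.
rewrite (dxC a c) (dxC a b) raddfMsign sign2 (signM _ (C b c a)) -mulrA.
by apply: signE; rewrite addbC.
Qed.

(** The canonical Poisson bracket.  The factor (-1)^a of its first term is
contained in the right derivative. *)
Definition poisson_sc F G := \sum_a (rdp a F * dx a G - dx a (twist (par a) F) * dp a G).

(** For odd arguments, the half of the Poisson bracket in which the first argument
is differentiated by momenta. *)
Definition contraction F G := \sum_a dp a F * dx a G.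

Lemma poisson_odd F G : has_parity true F -> has_parity true G ->
  poisson_sc F G = contraction F G + contraction G F.
Proof.
move=> hF hG; rewrite /contraction -big_split /=; apply: eq_bigr => a _.
rewrite rdp_odd // (twist_parity _ hF) raddfMsign -mulrA.
rewrite (supercommute (has_parity_dx a hF) (has_parity_dp a hG)).
by rewrite sign2; case: (par a); rewrite /= ?mulN1r ?mul1r ?opprK.
Qed.

(** The composition of two terms of an odd operator, with coefficients X and Y and
with derivatives of parities p and q, the coefficients being left
undifferentiated.  The two terms are odd, hence the sign. *)
Lemma odd_anticomm p q X Y F G : has_parity (~~ p) X -> has_parity (~~ q) Y ->
  F = (-1) ^+ (p && q) * G -> X * twist p Y * F = - (Y * twist q X * G).
Proof.
move=> hX hY ->; rewrite (twist_parity _ hX) (twist_parity _ hY) (signM _ X) (signM _ Y).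
rewrite (supercommute hX hY); move: (Y * X) => Z {hX hY}.
by case: p q => [] [] /=; rewrite ?expr0 ?expr1 ?mulN1r ?mul1r ?(mulNr, mulrN, opprK).
Qed.

(** * The square of an odd second order operator *)

Section Delta.
(** The coefficients s are those of S/2, so that no factor 1/2 is needed in the ring. *)
Context (s : I -> I -> P) (T : I -> P).
Context (s_sym : forall a b, s a b = (-1) ^+ (par a && par b) * s b a).
Context (s_parity : forall a b, has_parity (~~ (par a (+) par b)) (s a b)).
Context (T_parity : forall a, has_parity (~~ par a) (T a)).
Context (s_free : forall a b, pfree (s a b)).
Context (T_free : forall a, pfree (T a)).

Let S := symb2 s.
Let T_symb := symb1 T.
Let gam a := (\sum_b dx b (s b a) - T a) *+ 2.

Definition second_order_op G := op2 s G + op1 T G.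

Lemma has_parity_S : has_parity true S.
Proof.
apply: has_parity_sum => a; apply: has_parity_sum => b.
have := has_parityM (s_parity a b) (has_parityM (has_parity_pp b) (has_parity_pp a)).
by case: (par a); case: (par b).
Qed.

Lemma has_parity_T_symb : has_parity true T_symb.
Proof.
apply: has_parity_sum => a; have := has_parityM (T_parity a) (has_parity_pp a).
by case: (par a).
Qed.

Lemma dp_S a : dp a S = \sum_b s a b * pp b *+ 2.
Proof.
rewrite -rdp_odd; last exact: has_parity_S.
rewrite rdp_symb2 //; apply: eq_bigr => b _; rewrite mulr2n mulrDl; congr (_ + _).
by rewrite s_sym [par b && _]andbC sign2 addbb mul1r.
Qed.

Lemma dp_T_symb a : dp a T_symb = T a.
Proof. by rewrite -rdp_odd ?rdp_symb1 //; exact: has_parity_T_symb. Qed.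

Lemma dx_symb1 (C : I -> P) b : dx b (symb1 C) = symb1 (fun a => dx b (C a)).
Proof.
rewrite /symb1 raddf_sum; apply: eq_bigr => a _.
by rewrite dxM dx_pp mulr0 addr0.
Qed.

Lemma dx_symb2 (C : I -> I -> P) c :
  dx c (symb2 C) = symb2 (fun a b => dx c (C a b)).
Proof.
rewrite /symb2 raddf_sum; apply: eq_bigr => a _; rewrite raddf_sum.
by apply: eq_bigr => b _; rewrite !dxM !dx_pp !(mulr0, mul0r, addr0).
Qed.

Lemma op1_sum (J : finType) (C : I -> P) (F : J -> P) :
  op1 C (\sum_j F j) = \sum_j op1 C (F j).
Proof.
rewrite /op1 exchange_big /=; apply: eq_bigr => a _.
by rewrite raddf_sum mulr_sumr.
Qed.

Lemma op1D (C : I -> P) F G : op1 C (F + G) = op1 C F + op1 C G.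
Proof. by rewrite /op1 -big_split; apply: eq_bigr => a _; rewrite raddfD mulrDr. Qed.

Lemma op2_sum (J : finType) (C : I -> I -> P) (F : J -> P) :
  op2 C (\sum_j F j) = \sum_j op2 C (F j).
Proof.
rewrite /op2 [RHS]exchange_big /=; apply: eq_bigr => a _.
rewrite [RHS]exchange_big /=; apply: eq_bigr => b _.
by rewrite !raddf_sum mulr_sumr.
Qed.

Lemma op2D (C : I -> I -> P) F G : op2 C (F + G) = op2 C F + op2 C G.
Proof.
rewrite /op2 -big_split; apply: eq_bigr => a _; rewrite -big_split.
by apply: eq_bigr => b _; rewrite !raddfD mulrDr.
Qed.

Lemma op1M F G : op1 T (F * G) = op1 T F * G + \sum_a T a * twist (par a) F * dx a G.
Proof.
rewrite /op1 mulr_suml -big_split; apply: eq_bigr => a _ /=.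
by rewrite dxM mulrDr !mulrA.
Qed.

Lemma op2M F G : op2 s (F * G) = op2 s F * G +
  \sum_a (\sum_b s a b * dx b (twist (par a) F) *+ 2) * dx a G +
  \sum_a \sum_b s a b * twist (par a (+) par b) F * dx b (dx a G).
Proof.
have -> : \sum_a (\sum_b s a b * dx b (twist (par a) F) *+ 2) * dx a G =
   \sum_a \sum_b s a b * dx b (twist (par a) F) * dx a G +
   \sum_a \sum_b s a b * twist (par b) (dx a F) * dx b G.
  rewrite [X in _ + X]exchange_big -big_split; apply: eq_bigr => a _ /=.
  rewrite mulr_suml -big_split /=; apply: eq_bigr => b _.
  rewrite mulr2n mulrDl; congr (_ + _ * _).
  by rewrite [s b a]s_sym dx_twist signM mulrA [par b && _]andbC.
rewrite /op2 mulr_suml -!big_split; apply: eq_bigr => a _ /=.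
rewrite mulr_suml -!big_split; apply: eq_bigr => b _ /=.
rewrite dxM raddfD /= !dxM -!/(twist _ _) !mulrDr !mulrA.
have -> : twist (par a (+) par b) F = twist (par b) (twist (par a) F).
  by case: (par a); case: (par b); rewrite /twist //= tauK.
by rewrite -!addrA; congr (_ + _); rewrite addrCA.
Qed.

(** The coefficients of the square: C3 collects the terms in which one of the two
derivatives of the left factor falls on the coefficient s of the right factor, C2
those in which s is differentiated completely or T once, C1 those in which T is
differentiated completely. *)
Definition C3 c d a := \sum_b s a b * dx b (twist (par a) (s c d)) *+ 2.
Definition C2 c d := op2 s (s c d) + op1 T (s c d) +
   \sum_b s d b * dx b (twist (par d) (T c)) *+ 2.
Definition C1 c := op2 s (T c) + op1 T (T c).

(** The terms of orders four, three and two in which no coefficient is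
differentiated (z4, z3, z2) vanish by odd_anticomm. *)
Lemma second_order_sqr G : second_order_op (second_order_op G) = op3 C3 G + op2 C2 G + op1 C1 G.
Proof.
have z4 : \sum_c \sum_d \sum_a \sum_b
  s a b * twist (par a (+) par b) (s c d) * dx b (dx a (dx d (dx c G))) = 0.
  rewrite pair_bigA /=; under eq_bigr => u _ do rewrite pair_bigA /=.
  apply: sum_anti => -[c d] [a b] /=; apply: odd_anticomm => //.
  rewrite (dxC a d) raddfMsign (dxC b d) (dxC a c) !raddfMsign (dxC b c).
  rewrite !raddfMsign !sign2; apply: signE.
  by case: (par a); case: (par b); case: (par c); case: (par d).
have z3 : \sum_c \sum_d \sum_a T a * twist (par a) (s c d) * dx a (dx d (dx c G)) +
   \sum_c \sum_a \sum_b s a b * twist (par a (+) par b) (T c) * dx b (dx a (dx c G)) = 0.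
  under eq_bigr => c _ do rewrite exchange_big /=.
  rewrite exchange_big -big_split big1 //= => a _.
  rewrite -big_split big1 //= => c _; rewrite -big_split big1 //= => d _.
  apply/eqP; rewrite addr_eq0; apply/eqP; apply: odd_anticomm => //.
  rewrite (dxC a d) (dxC a c) raddfMsign sign2; apply: signE.
  by case: (par a); case: (par c); case: (par d).
have z2 : \sum_c \sum_a T a * twist (par a) (T c) * dx a (dx c G) = 0.
  by apply: sum_anti => a b; apply: odd_anticomm => //; apply: dxC.
have e22 : op2 s (op2 s G) = op2 (fun c d => op2 s (s c d)) G + op3 C3 G.
  rewrite [op2 s G]/op2 op2_sum; under eq_bigr => c _ do
    (rewrite op2_sum; under eq_bigr => d _ do rewrite op2M); rewrite -[RHS]addr0 -[in RHS]z4.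
  rewrite /op3 /(op2 (fun c d => _)) -!big_split; apply: eq_bigr => c _ /=.
  by rewrite -!big_split.
have e12 : op1 T (op2 s G) = op2 (fun c d => op1 T (s c d)) G +
   \sum_c \sum_d \sum_a T a * twist (par a) (s c d) * dx a (dx d (dx c G)).
  rewrite [op2 s G]/op2 op1_sum /(op2 (fun c d => _)) -big_split; apply: eq_bigr => c _ /=.
  by rewrite op1_sum -big_split; apply: eq_bigr => d _; rewrite op1M.
have e21 : op2 s (op1 T G) = op1 (fun c => op2 s (T c)) G +
   op2 (fun c d => \sum_b s d b * dx b (twist (par d) (T c)) *+ 2) G +
   \sum_c \sum_a \sum_b s a b * twist (par a (+) par b) (T c) * dx b (dx a (dx c G)).
  rewrite [op1 T G]/op1 op2_sum; under eq_bigr => c _ do rewrite op2M.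
  by rewrite [in RHS]/op1 /(op2 (fun c d => \sum_b _)) -!big_split.
have e11 : op1 T (op1 T G) = op1 (fun c => op1 T (T c)) G.
  rewrite [op1 T G]/op1 op1_sum; under eq_bigr => c _ do rewrite op1M.
  by rewrite big_split /= z2 addr0.
have eC2 : op2 C2 G = op2 (fun c d => op2 s (s c d)) G +
   op2 (fun c d => op1 T (s c d)) G +
   op2 (fun c d => \sum_b s d b * dx b (twist (par d) (T c)) *+ 2) G.
  rewrite /C2 /(op2 _ G) -!big_split; apply: eq_bigr => c _ /=.
  by rewrite -!big_split; apply: eq_bigr => d _; rewrite /= !mulrDl.
have eC1 : op1 C1 G = op1 (fun c => op2 s (T c)) G + op1 (fun c => op1 T (T c)) G.
  by rewrite /C1 /(op1 _ G) -big_split; apply: eq_bigr => c _ /=; rewrite mulrDl.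
rewrite /second_order_op op2D op1D e22 e12 e21 e11 eC2 eC1.
move/eqP: z3; rewrite addr_eq0 => /eqP ->.
set v := (\sum_c _).
by rewrite [LHS](AC (2*3*3) ((2*(1*6*4)*(3*8))*(5*7))) /= subrr addr0.
Qed.

Lemma ppC q a Y : has_parity q Y -> pp a * Y = twist (par a) Y * pp a.
Proof. by move=> h; rewrite (supercommute (has_parity_pp a) h) (twist_parity _ h) mulrA. Qed.

(** Moving p_a past Y turns the operator coefficients C3 and C2 into products of
derivatives of symbols. *)
Lemma s_dx_pp q a b Y Z : has_parity q Y ->
  s a b * dx b (twist (par a) Y) * (pp a * Z) = s b a * pp a * (dx b Y * Z).
Proof.
move=> h; rewrite (s_sym b a) dx_twist (signM _ (s a b)) !mulrA; congr (_ * _).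
rewrite -!mulrA (ppC _ (has_parity_dx b h)) andbC; congr (_ * _).
Qed.

Lemma contraction_S F : contraction S F = \sum_b \sum_a (s b a * pp a * dx b F) *+ 2.
Proof.
rewrite /contraction; apply: eq_bigr => b _; rewrite dp_S mulr_suml.
by apply: eq_bigr => a _; rewrite mulrnAl.
Qed.

(** That is, half of the Poisson bracket of S with itself. *)
Lemma symb3_C3 : symb3 C3 = contraction S S.
Proof.
rewrite contraction_S exchange_big /= /symb3.
under [RHS]eq_bigr => a _ do under eq_bigr => b _ do rewrite dx_symb2 /symb2
  mulr_sumr -sumrMnl.
under [RHS]eq_bigr => a _.
  rewrite exchange_big /=; under eq_bigr => c _ do (under eq_bigr => b _ do
   rewrite mulr_sumr -sumrMnl); under eq_bigr => c _ do rewrite exchange_big; over.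
rewrite [RHS]exchange_big /=; apply: eq_bigr => c _.
rewrite [RHS]exchange_big /=; apply: eq_bigr => d _; apply: eq_bigr => a _.
rewrite mulr_suml; apply: eq_bigr => b _; rewrite mulrnAl.
by rewrite (s_dx_pp _ _ _ (s_parity c d)).
Qed.

Lemma symb2_C2 : symb2 C2 = op2 s S + contraction T_symb S + contraction S T_symb.
Proof.
have -> : contraction T_symb S = op1 T S.
  by rewrite /contraction /op1; apply: eq_bigr => a _; rewrite dp_T_symb.
have -> : op2 s S = \sum_c \sum_d op2 s (s c d) * (pp d * pp c).
  rewrite /op2; under eq_bigr => a _ do under eq_bigr => b _ do
    rewrite !dx_symb2 /symb2 mulr_sumr.
  under eq_bigr => a _ do rewrite exchange_big /=.
  rewrite exchange_big /=; apply: eq_bigr => c _.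
  under eq_bigr => a _ do under eq_bigr => b _ do rewrite mulr_sumr.
  under eq_bigr => a _ do rewrite exchange_big /=.
  rewrite exchange_big /=; apply: eq_bigr => d _.
  rewrite mulr_suml; apply: eq_bigr => a _; rewrite mulr_suml.
  by apply: eq_bigr => b _; rewrite mulrA.
have -> : op1 T S = \sum_c \sum_d op1 T (s c d) * (pp d * pp c).
  rewrite /op1; under eq_bigr => a _ do rewrite !dx_symb2 /symb2 mulr_sumr.
  rewrite exchange_big /=; apply: eq_bigr => c _.
  under eq_bigr => a _ do rewrite mulr_sumr.
  rewrite exchange_big /=; apply: eq_bigr => d _.
  by rewrite mulr_suml; apply: eq_bigr => a _; rewrite mulrA.
rewrite contraction_S [X in _ = _ + X]exchange_big /=.
under [X in _ = _ + X]eq_bigr => a _ do under eq_bigr => b _ do rewrite dx_symb1 /symb1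
  mulr_sumr -sumrMnl.
under [X in _ = _ + X]eq_bigr => a _ do rewrite exchange_big /=.
rewrite [X in _ = _ + X]exchange_big /= -!big_split; apply: eq_bigr => c _ /=.
rewrite -!big_split; apply: eq_bigr => d _ /=; rewrite /C2 !mulrDl; congr (_ + _).
rewrite mulr_suml; apply: eq_bigr => b _; rewrite mulrnAl.
by rewrite (s_dx_pp _ _ _ (T_parity c)).
Qed.

(** The contribution of the derivatives of S to the upper connection. *)
Definition div_S := \sum_a dx a (dp a S).
Definition Gamma := symb1 gam.

Lemma GammaE : Gamma = div_S - T_symb *+ 2.
Proof.
rewrite /Gamma /div_S; under [X in _ = X - _]eq_bigr => a _ do rewrite dp_S raddf_sum.
rewrite exchange_big -sumrMnl -sumrB; apply: eq_bigr => a _ /=.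
rewrite /gam mulrnAl mulrBl mulrnBl mulr_suml -sumrMnl; congr (_ - _).
by apply: eq_bigr => b _; rewrite raddfMn /= dxM dx_pp mulr0 addr0.
Qed.

Lemma dpp_S a b : dp a (dp b S) = (-1) ^+ (par a && par b) * (s b a *+ 2).
Proof.
rewrite dp_S raddf_sum -(sum_delta (fun c => (-1) ^+ (par a && par b) * (s b c *+ 2)) a).
apply: eq_bigr => c _ /=; rewrite raddfMn /= (dpMh _ _ (s_parity b c)) s_free mul0r add0r.
rewrite dp_pp; case: eqVneq => [<-|_]; last by rewrite !mulr0 mul0rn mul0r.
rewrite mulr1 mul1r mulrnAr; congr (_ * _ *+ 2).
by case: (par a); case: (par b).
Qed.

(** The divergence of (S, S)/2.  The terms in which the two derivatives are
distributed crosswise over the two factors form an antisymmetric matrix and drop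
out; the rest is twice the part of the quadratic symbol symb2_C2 that the upper
connection does not account for. *)
Lemma divergence_contraction : \sum_a dx a (dp a (contraction S S)) =
  op2 s S *+ 2 + contraction S div_S + contraction div_S S.
Proof.
have e a b : dx a (dp a (dp b S * dx b S)) =
   s b a * dx a (dx b S) *+ 2 + dp b S * dx b (dx a (dp a S)) +
   dp b (dx a (dp a S)) * dx b S +
   (-1) ^+ par a * (dx a (dp b S) * dx b (dp a S)).
  rewrite (dpMh _ _ (has_parity_dp b has_parity_S)) raddfD raddfMsign /=.
  rewrite (dxMh _ _ (has_parity_dp a (has_parity_dp b has_parity_S))).
  rewrite (dxMh _ _ (has_parity_dp b has_parity_S)).
  rewrite mulrDr [RHS](AC 4 ((3*1)*(4*2))) /=; congr (_ + _ + (_ + _)).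
  - by rewrite (dpC a b) raddfMsign (dpdx b a) andbC.
  - rewrite dpp_S mulrA sign2 -mulrA mulrnAl.
    by case: (par a); case: (par b); rewrite /= ?mul1r.
  - rewrite (dpdx a b) (signM _ (dx a _)) sign2; apply: signE.
    by case: (par a); case: (par b).
  - rewrite sign2 addbb mul1r (dpdx a b) raddfMsign (dxC a b) sign2 addbb.
    by rewrite mul1r.
under eq_bigr => a _.
  rewrite raddf_sum raddf_sum; under eq_bigr => b _ do rewrite e.
  rewrite !big_split /=; over.
rewrite !big_split /= [X in _ + X]sum_anti ?addr0; last first.
  move=> a b; have X c d := has_parity_dx c (has_parity_dp d has_parity_S).
  rewrite (supercommute (X a b) (X b a)) sign2.
  by case: (par a); case: (par b); rewrite /= ?expr0 ?expr1 ?mulN1r ?mul1r ?opprK.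
congr (_ + _ + _).
- by rewrite /= -mulr2n [in LHS]exchange_big.
- rewrite exchange_big /=; apply: eq_bigr => b _.
  by rewrite -mulr_sumr -raddf_sum.
rewrite exchange_big /=; apply: eq_bigr => b _.
by rewrite -mulr_suml -raddf_sum.
Qed.

Lemma has_parity_div_S : has_parity true div_S.
Proof.
apply: has_parity_sum => a; have := has_parity_dx a (has_parity_dp a has_parity_S).
by rewrite addbA addbb.
Qed.

Lemma has_parity_Gamma : has_parity true Gamma.
Proof.
rewrite GammaE mulr2n; apply: has_parityB; first exact: has_parity_div_S.
by apply: has_parityD; exact: has_parity_T_symb.
Qed.

Lemma contractionDl F F' G : contraction (F + F') G = contraction F G + contraction F' G.
Proof.
by rewrite /contraction -big_split; apply: eq_bigr => a _; rewrite raddfD mulrDl.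
Qed.

Lemma contractionDr F G G' : contraction F (G + G') = contraction F G + contraction F G'.
Proof.
by rewrite /contraction -big_split; apply: eq_bigr => a _; rewrite raddfD mulrDr.
Qed.

Lemma contractionNl F G : contraction (- F) G = - contraction F G.
Proof. by rewrite /contraction -sumrN; apply: eq_bigr => a _; rewrite raddfN mulNr. Qed.

Lemma contractionNr F G : contraction F (- G) = - contraction F G.
Proof. by rewrite /contraction -sumrN; apply: eq_bigr => a _; rewrite raddfN mulrN. Qed.

(** From here on the bracket generated by the operator satisfies the Jacobi identity. *)
Context (SS0 : poisson_sc S S = 0).

Lemma contraction_SS0 : contraction S S = 0.
Proof. by apply: torsion2; rewrite -poisson_odd //; apply: has_parity_S. Qed.

(** With (S, S) = 0, divergence_contraction expresses op2 s S by contractions of S with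
its divergence, which complete the terms with T to the upper connection. *)
Lemma symb2_C2_Gamma : symb2 C2 *+ 2 = - poisson_sc S Gamma.
Proof.
have := divergence_contraction; rewrite contraction_SS0; under eq_bigr do rewrite !raddf0.
rewrite big1 // => e; rewrite poisson_odd; [|exact: has_parity_S|exact: has_parity_Gamma].
rewrite GammaE symb2_C2 !contractionDr !contractionDl !contractionNl !contractionNr.
rewrite !mulr2n contractionDl contractionDr.
apply/eqP; rewrite -addr_eq0 !opprD.
(* The first group is the divergence identity e; the other two cancel. *)
rewrite [X in X == _](AC (3*3*((1*2)*(1*2))) (((1*4)*7*10)*(2*5*(11*12))*(3*6*(8*9)))) /=.
by rewrite -!opprD !subrr !addr0 -mulr2n -e.
Qed.

Lemma pfree_C3 c d a : pfree (C3 c d a).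
Proof.
apply: pfree_sum => b; rewrite mulr2n; apply: pfreeD;
by apply: pfreeM => //; apply: pfree_dx; apply: pfree_twist.
Qed.

Lemma pfree_op2 X : pfree X -> pfree (op2 s X).
Proof.
move=> h; apply: pfree_sum => a; apply: pfree_sum => b.
by apply: pfreeM => //; do 2!apply: pfree_dx.
Qed.

Lemma pfree_op1 X : pfree X -> pfree (op1 T X).
Proof. by move=> h; apply: pfree_sum => a; apply: pfreeM => //; apply: pfree_dx. Qed.

Lemma pfree_C2 c d : pfree (C2 c d).
Proof.
apply: pfreeD; first by apply: pfreeD; [apply: pfree_op2 | apply: pfree_op1].
apply: pfree_sum => b; rewrite mulr2n; apply: pfreeD;
by apply: pfreeM => //; apply: pfree_dx; apply: pfree_twist.
Qed.

Lemma second_order_sqr_SS0 G : second_order_op (second_order_op G) = op2 C2 G + op1 C1 G.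
Proof.
rewrite second_order_sqr (symb3_op3 _ (C := C3)) ?add0r ?symb3_C3 ?contraction_SS0 //.
exact: pfree_C3.
Qed.

Lemma has_parity_C1 c : has_parity (par c) (C1 c).
Proof.
apply: has_parityD.
  apply: has_parity_sum => a; apply: has_parity_sum => b.
  have := has_parityM (s_parity a b) (has_parity_dx b (has_parity_dx a (T_parity c))).
  by case: (par a); case: (par b); case: (par c).
apply: has_parity_sum => a; have := has_parityM (T_parity a) (has_parity_dx a (T_parity c)).
by case: (par a); case: (par c).
Qed.

Lemma op1_C1M q F G : has_parity q F -> op1 C1 (F * G) = op1 C1 F * G + F * op1 C1 G.
Proof.
move=> hF; rewrite /op1 mulr_suml mulr_sumr -big_split; apply: eq_bigr => a _ /=.
rewrite dxM mulrDr mulrA [F * (_ * _)]mulrA; congr (_ + _).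
rewrite mulrA; congr (_ * _); rewrite -/(twist _ _) (twist_parity _ hF).
by rewrite (supercommute hF (has_parity_C1 a)) (signM _ (C1 a)) andbC.
Qed.

Lemma flat_second_order_sqr : poisson_sc S Gamma = 0 -> forall q F G, has_parity q F ->
  second_order_op (second_order_op (F * G)) =
  second_order_op (second_order_op F) * G + F * second_order_op (second_order_op G).
Proof.
move=> h q F G hF.
have h2 : symb2 C2 = 0 by apply: torsion2; rewrite -mulr2n symb2_C2_Gamma h oppr0.
have z X : second_order_op (second_order_op X) = op1 C1 X.
  by rewrite second_order_sqr_SS0 (symb2_op2 _ pfree_C2 h2) add0r.
by rewrite !z (op1_C1M _ hF).
Qed.

(** If a second order operator is a derivation, evaluating it on the products of two
coordinates shows that its second order coefficients are antisymmetric in the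
graded sense. *)
Lemma second_order_sqr_flat : (forall a b,
  second_order_op (second_order_op (xx a * xx b)) =
  second_order_op (second_order_op (xx a)) * xx b +
  xx a * second_order_op (second_order_op (xx b))) ->
  poisson_sc S Gamma = 0.
Proof.
move=> h; apply: oppr_inj; rewrite -symb2_C2_Gamma oppr0 sym_symb2 ?mul0rn // => a b.
have d1 c : dx c (1 : P) = 0.
  apply: (addrI (dx c 1)); rewrite addr0.
  by rewrite -[in RHS](mulr1 1) dxM rmorph1 if_same mulr1 mul1r.
have d2 c d e : dx c (dx d (xx e)) = 0 :> P.
  by rewrite dx_xx; case: eqP => _; rewrite ?d1 ?raddf0.
have z c : op2 C2 (xx c) = 0.
  by apply: big1 => d _; apply: big1 => e _; rewrite d2 mulr0.
have := h a b; rewrite !second_order_sqr_SS0 !z !add0r (op1_C1M _ (tau_xx _ a)) => /eqP.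
rewrite -subr_eq0 addrK => /eqP <-; rewrite /op2.
have e c d : C2 c d * dx d (dx c (xx a * xx b)) =
   (a == c)%:R * ((b == d)%:R * C2 c d) +
   (b == c)%:R * ((a == d)%:R * ((-1) ^+ (par a && par b) * C2 c d)).
  have k (t : bool) X : dx d (t%:R * X) = t%:R * dx d X.
    by case: t; rewrite ?mul1r // !mul0r raddf0.
  have k' (t : bool) X : X * t%:R = t%:R * X.
    by case: t; rewrite ?mul1r ?mulr1 // mul0r mulr0.
  rewrite (dxMh _ _ (tau_xx _ a)) raddfD raddfMsign /= !dx_xx k' !k !dx_xx.
  rewrite !(eq_sym a) !(eq_sym b) mulrDr; congr (_ + _).
    by rewrite mulrA k' k' !mulrA -[RHS]mulrA k' !mulrA.
  case: (eqVneq c b) => [->|_]; last by rewrite !mul0r !mulr0.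
  by rewrite !mul1r (signM _ (C2 b d)) k' (signM _ (d == a)%:R) andbC.
transitivity (\sum_c ((a == c)%:R * C2 c b +
   (b == c)%:R * ((-1) ^+ (par a && par b) * C2 c a))).
  by rewrite big_split /= !sum_delta.
apply: eq_bigr => c _; under eq_bigr => d _ do rewrite e.
by rewrite big_split /= -!mulr_sumr !sum_delta.
Qed.

End Delta.
End Calculus.

(** * Partial derivatives as derivations *)

Section Derivations.
Local Open Scope classical_set_scope.
Context {R : realType} {n m : nat} {W : opens R n}.
Local Notation P := (superfun m W).
Implicit Types (X Y Z : P) (F G : sfun R n m) (I : {set 'I_m}) (p q : bool) (j k : ix n m).

Let oW : open W := @oset_open R n W.

Lemma sf_regular X I x : oset W x -> regular_at (X I) x.
Proof. by move=> Wx; apply: smooth_regular Wx; exact: (sf_smooth X). Qed.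

Lemma partialZ (c : R) (f : 'rV[R]_n -> R) i x : regular_at f x ->
  partial i (fun y => c * f y) x = c * partial i f x.
Proof.
move=> rf; rewrite (partialM _ (regular_cst c x) rf) partial_cst mul0r.
exact: add0r.
Qed.

Lemma partial_pd_odd i (k : 'I_m) F I x : regular_at (F (k |: I)%SET) x ->
  partial i (pd (inr k) F I) x = pd (inr k) (pd (inl i) F) I x.
Proof.
move=> rF; rewrite /pd /=; case: (k \in I); first exact: (partial_cst 0 i x).
exact: partialZ.
Qed.

Fact sf_der_zmod j : zmod_morphism (@sf_der R n m W j).
Proof.
move=> X Y; apply: superfun_ext => I x Wx.
rewrite (rep_der j (repB (rep_self X) (rep_self Y))) //.
rewrite (repB (rep_der j (rep_self X)) (rep_der j (rep_self Y))) //.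
rewrite -[RHS]/(pd j X I x - pd j Y I x); case: j => [i|k] /=.
  have e y : oset W y -> (sfval X - sfval Y) I y = X I y + (-1) * Y I y.
    by move=> _; rewrite -[LHS]/(X I y - Y I y) mulN1r.
  rewrite (partial_eq i oW Wx e) partialD; last 2 first.
  - exact: sf_regular.
  - by apply: regularM; [exact: regular_cst | exact: sf_regular].
  by rewrite partialZ ?mulN1r //; exact: sf_regular.
case: (k \in I); first by rewrite subr0.
by rewrite -mulrBr.
Qed.

HB.instance Definition _ j :=
  GRing.isZmodMorphism.Build P P (@sf_der R n m W j) (@sf_der_zmod j).

Lemma sf_derM j X Y : sf_der j (X * Y) =
  sf_der j X * Y + (if par j then sf_tau X else X) * sf_der j Y.
Proof.
apply: superfun_ext => I x Wx; rewrite (rep_der j (repM (rep_self X) (rep_self Y))) //.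
have repT : rep (if par j then sf_tau X else X) (if par j then stwist true X else X).
  by case: (par j); [exact: rep_tau | exact: rep_self].
rewrite (repD (repM (rep_der j (rep_self X)) (rep_self Y))
              (repM repT (rep_der j (rep_self Y)))) //.
case: j {repT} => [i|k]; last exact: pd_oddM.
rewrite -[RHS]/(smul (pd (inl i) X) Y I x + smul X (pd (inl i) Y) I x) /=.
have s J := sf_smooth X J; have s' J := sf_smooth Y J.
rewrite (partial_sum _ _ _ oW Wx); last first.
  move=> J; apply: smoothM; [exact: oW | apply: smooth_cst; exact: oW|].
  by apply: smoothM (s _) (s' _); exact: oW.
rewrite -big_split; apply: eq_bigr => J _ /=.
rewrite -mulrDr partialZ; last by apply: regularM; exact: sf_regular.
by rewrite partialM //; exact: sf_regular.
Qed.

Lemma sf_derC j k X :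
  sf_der j (sf_der k X) = (-1) ^+ (par j && par k) * sf_der k (sf_der j X).
Proof.
apply: superfun_ext => I x Wx.
rewrite (rep_der j (rep_der k (rep_self X))) //.
rewrite (rep_sign _ (rep_der k (rep_der j (rep_self X)))) // /sscale.
case: j => [i|j]; case: k => [l|k].
- rewrite [(-1) ^+ _](_ : _ = 1) // mul1r.
  exact: (partialC i l oW Wx (sf_smooth X I)).
- rewrite [(-1) ^+ _](_ : _ = 1) // mul1r.
  by apply: partial_pd_odd; exact: sf_regular.
- rewrite [(-1) ^+ _](_ : _ = 1) // mul1r; apply/esym.
  by apply: partial_pd_odd; exact: sf_regular.
by rewrite pd_oddC mulN1r.
Qed.

Lemma sf_tau_der j X :
  sf_tau (sf_der j X) = (-1) ^+ par j * sf_der j (sf_tau X).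
Proof.
apply: superfun_ext => I x Wx.
rewrite (rep_tau (rep_der j (rep_self X))) //.
rewrite (rep_sign _ (rep_der j (rep_tau (rep_self X)))) // /sscale.
case: j => [i|k].
  by rewrite [(-1) ^+ par _](_ : _ = 1) // mul1r /= /stwist partialZ //; exact: sf_regular.
by rewrite pd_odd_twist mulrA -expr2 sqrr_sign mul1r.
Qed.

Lemma sf_tau_coord j : sf_tau (sf_coord j) = (-1) ^+ par j * sf_coord j :> P.
Proof.
apply: superfun_ext => I x Wx.
rewrite (rep_tau (rep_mk _)) // (rep_sign _ (rep_mk _)) // /sscale /stwist mul1n.
case: j => [i|k] /=; case: eqP => [->|_]; rewrite ?mulr0 //.
  by rewrite cards0 !expr0.
by rewrite cards1.
Qed.

Lemma sf_der_coord j k : sf_der j (sf_coord k) = (j == k)%:R :> P.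
Proof.
have rd : rep ((j == k)%:R : P) (sconst (j == k)%:R : sfun R n m).
  case: (j == k) => /=; first exact: rep1.
  by move=> I x Wx; rewrite rep0 // /sconst if_same.
apply: superfun_ext => I x Wx; rewrite (rep_der j (rep_mk _)) // rd // /sconst.
case: j {rd} => [i|j]; case: k => [l|k].
- rewrite /= (inj_eq (@inl_inj _ _)); have [->|I0] := eqVneq I finset.set0.
    by rewrite -(partial_coord l i x); apply: (partial_eq i oW Wx) => y _; rewrite /= eqxx.
  rewrite -(partial_cst 0 i x); apply: (partial_eq i oW Wx) => y _.
  by rewrite /= (negbTE I0).
- rewrite /= if_same -[RHS](partial_cst (I == [set k]%SET)%:R i x).
  exact: (partial_eq i oW Wx).
- rewrite /=; case: (j \in I); rewrite if_same // ifF ?mulr0 //.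
  by apply/negbTE/finset.set0Pn; exists j; rewrite !inE eqxx.
rewrite pd_oddE /= (inj_eq (@inr_inj _ _)).
have [->|I0] := eqVneq I finset.set0.
  by rewrite finset.setU0 exsign0r mul1r (inj_eq finset.set1_inj).
case: eqP => [e|_]; last by rewrite mulr0.
case/finset.set0Pn: I0 => i iI; rewrite exsign1.
have : i \in [set k]%SET by rewrite -e !inE iI orbT.
rewrite inE => /eqP ik; have : j \in [set k]%SET by rewrite -e !inE eqxx.
by rewrite inE => /eqP ->; rewrite -ik iI mul0r.
Qed.

End Derivations.

(** * Pull-back of superfunctions to the cotangent bundle *)

Section CotangentPull.
Local Open Scope classical_set_scope.
Context {R : realType} {n m : nat}.
Implicit Types (F G : sfun R n m) (I J K : {set 'I_(m + m)}) (W : set 'rV[R]_n).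
Implicit Types (z : 'rV[R]_(n + n)).

Import boot.finset.

Let lm : 'I_m -> 'I_(m + m) := @lshift m m.
Let lm_inj : injective lm := @lshift_inj m m.

(** The index sets of pull-backs are the images of those on the base. *)
Lemma pullE F I z : pull F I z =
  \sum_(J : {set 'I_m}) (I == lm @: J)%SET%:R * F J (lsubmx z).
Proof.
rewrite /pull; case: ifP => [/forall_inP hI|hI].
  set I' := [set j | _]%SET.
  have e : I = (lm @: I')%SET.
    apply/setP => k; apply/idP/imsetP => [kI|[j + ->]]; last by rewrite inE.
    have km := hI k kI; exists (Ordinal km); last exact: val_inj.
    rewrite inE; have -> // : lshift m (Ordinal km) = k by exact: val_inj.
  rewrite (bigD1 I') //= -e eqxx mul1r big1 ?addr0 // => J JI.
  case: eqP => [e'|]; last by rewrite mul0r.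
  by case/eqP: JI; apply: (imset_inj lm_inj); rewrite -e' -e.
rewrite big1 // => J _; case: eqP => [e|_]; last by rewrite mul0r.
case/negP: hI; apply/forall_inP => k; rewrite e => /imsetP[j _ ->].
exact: (ltn_ord j).
Qed.

Lemma inversions_lm (J K : {set 'I_m}) : inversions (lm @: J) (lm @: K) = inversions J K.
Proof.
rewrite !inversionsE big_imset /=; last by move=> x y _ _; exact: lm_inj.
apply: eq_bigr => j _; rewrite big_imset //=; by move=> x y _ _; exact: lm_inj.
Qed.

Lemma exsign_lm (J K : {set 'I_m}) : exsign (lm @: J) (lm @: K) = exsign J K :> R.
Proof.
by rewrite /exsign inversions_lm -!setI_eq0 -imsetI ?imset_eq0 // => x y _ _; exact: lm_inj.
Qed.

Lemma pullM F G I z : pull (smul F G) I z = smul (pull F) (pull G) I z.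
Proof.
pose x := lsubmx z.
transitivity (\sum_(J : {set 'I_m}) \sum_(K : {set 'I_m})
    (I == lm @: (J :|: K))%SET%:R * (exsign J K * (F J x * G K x))).
  rewrite pullE; under eq_bigr => L _ do rewrite smulE mulr_sumr.
  rewrite exchange_big /=; apply: eq_bigr => J _.
  under eq_bigr => L _ do rewrite mulr_sumr.
  rewrite exchange_big /=; apply: eq_bigr => K _.
  under eq_bigr => L _ do rewrite mulrCA.
  exact: (sum_eq (J :|: K)%SET
    (fun L : {set 'I_m} => (I == lm @: L)%SET%:R * (exsign J K * (F J x * G K x)))).
rewrite smulE; symmetry.
transitivity (\sum_(A : {set 'I_(m + m)}) \sum_(B : {set 'I_(m + m)})
   \sum_(J : {set 'I_m}) \sum_(K : {set 'I_m})
    (lm @: J == A)%SET%:R * ((lm @: K == B)%SET%:R *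
     ((A :|: B == I)%SET%:R * (exsign A B * (F J x * G K x))))).
  apply: eq_bigr => A _; apply: eq_bigr => B _; rewrite !pullE.
  rewrite mulr_suml !mulr_sumr; apply: eq_bigr => J _.
  rewrite !mulr_sumr; apply: eq_bigr => K _.
  by rewrite ![_ == lm @: _]eq_sym -/x; ring.
under eq_bigr => A _ do rewrite exchange_big /=.
rewrite exchange_big /=; apply: eq_bigr => J _.
under eq_bigr => A _ do under eq_bigr => B _ do rewrite -mulr_sumr.
under eq_bigr => A _ do under eq_bigr => B _ do rewrite mulr_sumr.
under eq_bigr => A _ do rewrite exchange_big /=.
rewrite exchange_big /=; apply: eq_bigr => K _.
under eq_bigr => A _ do rewrite -mulr_sumr.
rewrite (sum_eq _ (fun A : {set 'I_(m + m)} => \sum_B (lm @: K == B)%SET%:R *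
     ((A :|: B == I)%SET%:R * (exsign A B * (F J x * G K x))))).
rewrite (sum_eq _ (fun B : {set 'I_(m + m)} =>
     ((lm @: J :|: B == I)%SET%:R * (exsign (lm @: J) B * (F J x * G K x))))).
by rewrite exsign_lm imsetU eq_sym.
Qed.

Lemma pull_im F (J : {set 'I_m}) z : pull F (lm @: J) z = F J (lsubmx z).
Proof.
rewrite pullE (bigD1 J) //= eqxx mul1r big1 ?addr0 // => K /negbTE KJ.
by rewrite (inj_eq (imset_inj lm_inj)) eq_sym KJ mul0r.
Qed.

Lemma pull_nim F I z : (forall J : {set 'I_m}, I != (lm @: J)%SET) -> pull F I z = 0.
Proof. by move=> h; rewrite pullE big1 // => J _; rewrite (negbTE (h J)) mul0r. Qed.

(** The pull-back is supported on the index sets of the first kind. *)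
Lemma pull_case I : (exists J : {set 'I_m}, I = (lm @: J)%SET) \/
  (forall J : {set 'I_m}, I != (lm @: J)%SET).
Proof.
have [/existsP[J /eqP e]|] := boolP [exists J : {set 'I_m}, I == (lm @: J)%SET].
  by left; exists J.
by rewrite negb_exists => /forallP; right.
Qed.

Lemma pd_pos_pull a F I z : pd (pos_ix a) (pull F) I z = pull (pd a F) I z.
Proof.
case: a => [i|j]; rewrite [pos_ix _]/=.
  rewrite /pd /pull; case: [forall k in I, (k < m)%N]; first exact: (partial_pull_l (F _) i z).
  exact: (partial_cst 0 (lshift n i) z).
rewrite pd_oddE; case: (pull_case I) => [[J ->]|h].
  rewrite pull_im pd_oddE -/lm; have -> : (lm j |: lm @: J = lm @: (j |: J))%SET.
    by rewrite imsetU1.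
  by rewrite pull_im -[[set lm j]%SET]imset_set1 exsign_lm.
rewrite (pull_nim (pd _ _)) // -/lm; have [jI|jI] := boolP (lm j \in I).
  by rewrite exsign1 jI mul0r.
rewrite pull_nim ?mulr0 // => J; apply/eqP => e.
case/negP: (h (J :\ j)%SET); apply/eqP; rewrite -(setU1K jI) e.
apply/setP => k; rewrite !inE; apply/andP/imsetP => [[kj /imsetP[l lJ kl]]|[l + ->]].
  exists l => //; rewrite !inE lJ andbT; apply: contraNneq kj => <-.
  by rewrite kl.
by rewrite !inE (inj_eq lm_inj) => /andP[-> lJ]; rewrite imset_f.
Qed.

Lemma pd_mom_pull a F I z : pd (mom_ix a) (pull F) I z = 0.
Proof.
case: a => [i|j]; rewrite [mom_ix _]/=.
  rewrite /pd /pull; case: [forall k in I, (k < m)%N]; first exact: (partial_pull_r (F _) i z).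
  exact: (partial_cst 0 (rshift n i) z).
rewrite pd_oddE pull_nim ?mulr0 // => J; apply/eqP => /setP/(_ (rshift m j)).
rewrite !inE eqxx /= => /esym/imsetP[k _ /eqP].
by rewrite eq_sym eq_lrshift.
Qed.

Lemma pull_ext W F G : eq_on W F G -> eq_on (cotangent W) (pull F) (pull G).
Proof. by move=> FG I z Wz; rewrite /pull; case: ifP => // _; exact: FG. Qed.

Lemma pullD F G I z : pull (F + G) I z = pull F I z + pull G I z.
Proof. by rewrite /pull; case: ifP => // _; rewrite addr0. Qed.

Lemma pull_scale c F I z : pull (sscale c F) I z = c * pull F I z.
Proof. by rewrite /pull; case: ifP => // _; rewrite mulr0. Qed.

Lemma pull_parity W p F : shomog W p F -> shomog (cotangent W) p (pull F).
Proof.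
move=> hF I z Wz; case: (pull_case I) => [[J ->]|h _]; last exact: pull_nim.
by rewrite pull_im card_imset //; apply: hF.
Qed.

(** Evaluation on the zero section recovers a function from its pull-back. *)
Lemma pull_inj W F G : eq_on (cotangent W) (pull F) (pull G) -> eq_on W F G.
Proof.
move=> h I x Wx; have := h (lm @: I)%SET (row_mx x 0).
by rewrite !pull_im /cotangent /= row_mxKl; apply.
Qed.

Lemma ssmooth_pull W F : open W -> ssmooth_on W F -> ssmooth_on (cotangent W) (pull F).
Proof.
move=> oW sF I; rewrite /pull; case: [forall k in I, (k < m)%N]; first exact: smooth_pull.
by apply: smooth_cst; exact: open_cotangent.
Qed.

End CotangentPull.

Section CotangentCalculus.
Local Open Scope classical_set_scope.
Context {R : realType} {n m : nat} (W : opens R n).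

Definition cotangent_open : opens R (n + n) := Opens (open_cotangent (@oset_open R n W)).

Local Notation P := (superfun (m + m) cotangent_open).

Lemma par_pos (a : ix n m) : par (pos_ix a) = par a. Proof. by case: a. Qed.
Lemma par_mom (a : ix n m) : par (mom_ix a) = par a. Proof. by case: a. Qed.

Lemma pos_ix_inj : injective (@pos_ix n m).
Proof. by move=> [i|i] [k|k] //= [] /val_inj ->. Qed.

Lemma mom_ix_inj : injective (@mom_ix n m).
Proof. by move=> [i|i] [k|k] //= [] /addnI/val_inj ->. Qed.

Lemma pos_mom (a b : ix n m) : (pos_ix a == mom_ix b) = false.
Proof.
by case: a b => [i|i] [k|k] //; apply/negP => /eqP [] e;
  have := ltn_ord i; rewrite e ltnNge leq_addr.
Qed.

Definition cotangent_calculus : supercalculus (@par n m).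
Proof.
apply: (@Supercalculus _ _ P (@sf_tau R (n + n) (m + m) cotangent_open)
   (fun a => @sf_der R (n + n) (m + m) cotangent_open (pos_ix a))
   (fun a => @sf_der R (n + n) (m + m) cotangent_open (mom_ix a))
   (fun a => sf_coord (pos_ix a)) (fun a => sf_coord (mom_ix a))).
- exact: sf_torsion.
- exact: sf_tauK.
- exact: sf_comm.
- by move=> a X; rewrite -(par_pos a); exact: sf_tau_der.
- by move=> a X; rewrite -(par_mom a); exact: sf_tau_der.
- by move=> a X Y; rewrite -(par_pos a); exact: sf_derM.
- by move=> a X Y; rewrite -(par_mom a); exact: sf_derM.
- by move=> a b X; rewrite -(par_pos a) -(par_pos b); exact: sf_derC.
- by move=> a b X; rewrite -(par_mom a) -(par_mom b); exact: sf_derC.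
- by move=> a b X; rewrite -(par_mom a) -(par_pos b); exact: sf_derC.
- by move=> a; rewrite -(par_pos a); exact: sf_tau_coord.
- by move=> a; rewrite -(par_mom a); exact: sf_tau_coord.
- by move=> a b; rewrite -(inj_eq pos_ix_inj); exact: sf_der_coord.
- move=> a b; have := @sf_der_coord R (n + n) (m + m) cotangent_open (pos_ix a) (mom_ix b).
  by rewrite pos_mom.
- by move=> a b; rewrite -(inj_eq mom_ix_inj); exact: sf_der_coord.
Defined.

End CotangentCalculus.

(** * Coordinate expressions on the cotangent bundle *)

Section PullEquations.
Local Open Scope classical_set_scope.
Context {R : realType} {n m : nat}.
Implicit Types (F G : sfun R n m) (a b : ix n m).

Lemma pull_smul F G : pull (smul F G) = smul (pull F) (pull G).
Proof. by apply/funext => I; apply/funext => z; exact: pullM. Qed.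

Lemma pull_pd a F : pd (pos_ix a) (pull F) = pull (pd a F).
Proof. by apply/funext => I; apply/funext => z; exact: pd_pos_pull. Qed.

Lemma pull_sscale c F : pull (sscale c F) = sscale c (pull F).
Proof. by apply/funext => I; apply/funext => z; exact: pull_scale. Qed.

Lemma pull_add F G : pull (F + G) = pull F + pull G.
Proof. by apply/funext => I; apply/funext => z; exact: pullD. Qed.

Lemma pull0 : pull (0 : sfun R n m) = 0.
Proof. by apply/funext => I; apply/funext => z; rewrite /pull; case: ifP. Qed.

Lemma pull_sum (J : finType) (F : J -> sfun R n m) :
  pull (\sum_i F i) = \sum_i pull (F i).
Proof. exact: (big_morph _ pull_add pull0). Qed.

Lemma pull_opp F : pull (- F) = - pull F.
Proof. by apply: (addrI (pull F)); rewrite -pull_add !subrr pull0. Qed.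

Lemma pull_scoord a : pull (scoord a) = scoord (pos_ix a) :> sfun R _ _.
Proof.
apply/funext => I; apply/funext => z; case: (pull_case I) => [[J ->]|h].
  rewrite pull_im; case: a => [i|j] /=; first by rewrite imset_eq0 mxE.
  by rewrite -imset_set1 (inj_eq (imset_inj (@lshift_inj _ _))).
rewrite pull_nim //; case: a => [i|j] /=; first last.
  by rewrite -imset_set1 (negbTE (h _)).
by rewrite -(imset0 (@lshift m m)) (negbTE (h _)).
Qed.

Context {N L : nat}.
Implicit Types A B : sfun R N L.

Lemma sscale_sum (J : finType) c (A : J -> sfun R N L) :
  sscale c (\sum_i A i) = \sum_i sscale c (A i).
Proof.
apply: (big_morph (sscale c)) => [A1 A2|]; apply/funext => I; apply/funext => z.
  exact: mulrDr.
exact: mulr0.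
Qed.

Lemma smul_scale c A B : smul (sscale c A) B = sscale c (smul A B).
Proof.
apply/funext => I; apply/funext => z; rewrite /smul /sscale mulr_sumr.
by apply: eq_bigr => J _; rewrite -mulrA mulrCA.
Qed.

Lemma sscaleA c d A : sscale c (sscale d A) = sscale (c * d) A.
Proof. by apply/funext => I; apply/funext => z; exact: mulrA. Qed.

Lemma sscale1 A : sscale 1 A = A.
Proof. by apply/funext => I; apply/funext => z; exact: mul1r. Qed.

End PullEquations.

Section Representation.
Local Open Scope classical_set_scope.
Context {R : realType} {n m : nat} (W : opens R n).
Local Notation P := (cotangent_calculus (m := m) W).
Implicit Types (X Y : P) (F G : sfun R (n + n) (m + m)) (p : bool) (a : ix n m).

(** The relation rep, at the type of the calculus, so that the rules below apply to
its operations. *)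
Definition crep X F := @rep R (n + n) (m + m) (cotangent_open W) X F.

Lemma crepD X Y F G : crep X F -> crep Y G -> crep (X + Y) (F + G).
Proof. exact: repD. Qed.
Lemma crepB X Y F G : crep X F -> crep Y G -> crep (X - Y) (F - G).
Proof. exact: repB. Qed.
Lemma crepM X Y F G : crep X F -> crep Y G -> crep (X * Y) (smul F G).
Proof. exact: repM. Qed.
Lemma crep_sum (J : finType) (X : J -> P) (F : J -> sfun R (n + n) (m + m)) :
  (forall i, crep (X i) (F i)) -> crep (\sum_i X i) (\sum_i F i).
Proof. exact: rep_sum. Qed.
Lemma crep_sign p X F : crep X F -> crep ((-1) ^+ p * X) (sscale ((-1) ^+ p) F).
Proof. exact: rep_sign. Qed.
Lemma crep_mulrn (k : nat) X F : crep X F -> crep (X *+ k) (sscale k%:R F).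
Proof. exact: rep_mulrn. Qed.
Lemma crep_dx a X F : crep X F -> crep (dx a X) (pd (pos_ix a) F).
Proof. exact: rep_der. Qed.
Lemma crep_dp a X F : crep X F -> crep (dp a X) (pd (mom_ix a) F).
Proof. exact: rep_der. Qed.
Lemma crep_tau X F : crep X F -> crep (tau X) (stwist true F).
Proof. exact: rep_tau. Qed.
Lemma crep_pp a : crep (pp a) (mom a).
Proof. exact: rep_mk. Qed.
Lemma crep_xx a : crep (xx a) (scoord (pos_ix a)).
Proof. exact: rep_mk. Qed.
Lemma crep_inj X Y F : crep X F -> crep Y F -> X = Y.
Proof. exact: rep_inj. Qed.
Lemma crep0 : crep 0 0.
Proof. exact: rep0. Qed.
Lemma crep_eq X F G : eq_on (cotangent W) F G -> crep X F -> crep X G.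
Proof. by move=> FG XF I z Wz; rewrite XF // FG. Qed.

Lemma crep_eq0 X F : crep X F -> (X = 0 <-> eq_on (cotangent W) F 0).
Proof.
move=> XF; split=> [X0 I z Wz|F0].
  by rewrite -XF // X0; exact: crep0.
exact: (crep_inj (crep_eq F0 XF) crep0).
Qed.

Lemma crep_tw p X F : crep X F -> crep (twist p X) (stwist p F).
Proof.
case: p => XF; first exact: crep_tau.
by move=> I z Wz; rewrite /stwist mul0n expr0 mul1r; exact: XF.
Qed.

Lemma crep_poisson X Y F G : crep X F -> crep Y G -> crep (poisson_sc X Y) (poisson F G).
Proof.
move=> XF YG; apply: crep_sum => a; apply: crepB.
  rewrite /rdp -mulrA; apply: crep_sign; apply: crepM; last exact: crep_dx.
  by apply: crep_dp; exact: crep_tw.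
by apply: crepM; [apply: crep_dx; exact: crep_tw | exact: crep_dp].
Qed.

Lemma crep_parity p X F : crep X F -> shomog (cotangent W) p F -> has_parity p X.
Proof.
move=> XF hF; apply: (crep_inj (crep_tau XF)).
apply: crep_eq (crep_sign p XF) => I z Wz; rewrite /sscale /stwist mul1n.
have [<-|/hF ->] := eqVneq (odd #|I|) p; first by rewrite signr_odd.
  by rewrite !mulr0.
by [].
Qed.

Lemma crep_free X (F : sfun R n m) : crep X (pull F) -> pfree X.
Proof.
move=> XF a; apply: (crep_inj _ crep0); apply: crep_eq (crep_dp a XF) => I z _.
exact: pd_mom_pull.
Qed.

End Representation.

(** * Operators in a chart *)

Section Chart.
Local Open Scope classical_set_scope.
Context {R : realType} {n m : nat} {M : superspace R} {c : chart n m M}.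
Context {V : set (pt M)} (oV : open V) (sV : V `<=` cdom c).

Definition image_open : opens R n := Opens (cmap_open oV sV).
Local Notation W := image_open.
Local Notation P := (cotangent_calculus (m := m) W).
Implicit Types f g : sec V.

(** Sections over V, seen as functions on the cotangent bundle of the image of V. *)
Definition lift_sec f : P := mk_superfun (W := cotangent_open W)
  (ssmooth_pull (@oset_open R n W) (coef_smooth oV sV f)).

Lemma crep_lift f : crep (lift_sec f) (pull (coef c f)).
Proof. exact: rep_mk. Qed.

Lemma lift_inj : injective lift_sec.
Proof.
move=> f g e; apply: (coef_inj oV sV); apply: pull_inj => I z Wz.
by rewrite -(crep_lift f) // e; exact: crep_lift.
Qed.

Lemma liftD f g : lift_sec (f + g) = lift_sec f + lift_sec g.
Proof.
apply: (crep_inj (crep_lift _)).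
apply: crep_eq (crepD (crep_lift f) (crep_lift g)); rewrite -pull_add.
by apply: pull_ext => I x Wx; rewrite coefD.
Qed.

Lemma liftM f g : lift_sec (f * g) = lift_sec f * lift_sec g.
Proof.
apply: (crep_inj (crep_lift _)).
apply: crep_eq (crepM (crep_lift f) (crep_lift g)); rewrite -pull_smul.
by apply: pull_ext => I x Wx; rewrite coefM.
Qed.

Lemma lift_parity p f : homog p f -> has_parity p (lift_sec f).
Proof.
move=> /(coef_homog oV sV) h; apply: (crep_parity (crep_lift f)).
exact: pull_parity.
Qed.

End Chart.

Section LocalForm.
Local Open Scope classical_set_scope.
Context {R : realType} {n m : nat} {M : superspace R} {Delta : operator M}.
Context {c : chart n m M}.
Context {S : ix n m -> ix n m -> sec (cdom c)} {T : ix n m -> sec (cdom c)}.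
Context (local : local_form Delta S T).
Context {V : set (pt M)} (oV : open V) (sV : V `<=` cdom c).
Local Notation W := (image_open oV sV).
Local Notation P := (cotangent_calculus (m := m) W).
Local Notation lift := (lift_sec oV sV).
Local Notation Sc := (fun a b => coef c (S a b)).
Local Notation Tc := (fun a => coef c (T a)).
Implicit Types (f g : sec V) (a b : ix n m).

Let sW : W `<=` cmap c @` cdom c.
Proof. by move=> _ [x Vx <-]; exists x => //; exact: sV. Qed.

Lemma coef_smooth_image (f : sec (cdom c)) : ssmooth_on W (coef c f).
Proof.
move=> I; apply: (smooth_mono sW).
exact: (coef_smooth (cdom_open c) (fun x Vx => Vx) f).
Qed.

Definition half_S a b : P := mk_superfun (W := cotangent_open W)
  (ssmooth_pull (@oset_open R n W) (@ssmooth_scale _ _ _ W 2^-1 _ (coef_smooth_image (S a b)))).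

Definition lift_T a : P := mk_superfun (W := cotangent_open W)
  (ssmooth_pull (@oset_open R n W) (coef_smooth_image (T a))).

Lemma crep_half_S a b : crep (half_S a b) (pull (sscale 2^-1 (Sc a b))).
Proof. exact: rep_mk. Qed.

Lemma crep_lift_T a : crep (lift_T a) (pull (Tc a)).
Proof. exact: rep_mk. Qed.

Lemma crep_S a b : crep (half_S a b *+ 2) (pull (Sc a b)).
Proof.
have := crep_mulrn 2 (crep_half_S a b).
by rewrite -pull_sscale sscaleA mulfV ?pnatr_eq0 // sscale1.
Qed.

Lemma coef_image_homog p (f : sec (cdom c)) : homog p f -> shomog W p (coef c f).
Proof.
move=> /(coef_homog (cdom_open c) (fun x Vx => Vx)) h I x Wx.
by apply: h; exact: sW.
Qed.

Lemma half_S_parity a b : has_parity (~~ (par a (+) par b)) (half_S a b).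
Proof.
case: local => _ hS _ _; apply: (crep_parity (crep_half_S a b)); apply: pull_parity.
move=> I x Wx hI; rewrite /sscale (coef_image_homog (hS a b)) ?mulr0 //.
by rewrite addbT.
Qed.

Lemma lift_T_parity a : has_parity (~~ par a) (lift_T a).
Proof.
case: local => _ _ hT _; apply: (crep_parity (crep_lift_T a)); apply: pull_parity.
by have := coef_image_homog (hT a); rewrite addbT.
Qed.

Lemma half_S_free a b : pfree (half_S a b).
Proof. exact: crep_free (crep_half_S a b). Qed.

Lemma lift_T_free a : pfree (lift_T a).
Proof. exact: crep_free (crep_lift_T a). Qed.

Lemma coefN (f : sec (cdom c)) : eq_on W (coef c (- f)) (- coef c f).
Proof.
have cD := coefD (cdom_open c) (fun x Vx => Vx).
have c0 : eq_on W (coef c (0 : sec (cdom c))) 0.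
  move=> I x /sW Wx; have := cD 0 0 I x Wx; rewrite addr0 => e.
  by apply: (addrI (coef c (0 : sec (cdom c)) I x)); rewrite -[LHS]e addr0.
move=> I x Wx; apply: (addrI (coef c f I x)).
rewrite -[RHS]/(coef c f I x - coef c f I x) subrr.
by rewrite -[LHS](cD f (- f) I x (sW Wx)) subrr c0.
Qed.

Lemma half_S_sym a b : half_S a b = (-1) ^+ (par a && par b) * half_S b a.
Proof.
apply: (crep_inj (crep_half_S a b)).
apply: crep_eq (crep_sign _ (crep_half_S b a)) => I z Wz.
rewrite /sscale -[LHS]pull_scale; apply: pull_ext Wz => {}I x Wx; rewrite /sscale.
case: local => /(_ a b) -> _ _ _; case: (par a && par b); last by rewrite !mul1r.
by rewrite !mulN1r coefN // mulrN.
Qed.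

Lemma crep_symbol : crep (symb2 half_S) (symbol Sc).
Proof.
rewrite /symbol sscale_sum; apply: crep_sum => a.
rewrite sscale_sum; apply: crep_sum => b.
rewrite -smul_scale -pull_sscale; apply: crepM; first exact: crep_half_S.
by apply: crepM; exact: crep_pp.
Qed.

Lemma crep_upper : crep (Gamma half_S lift_T) (upper_connection Sc Tc).
Proof.
apply: crep_sum => a; apply: crepM; last exact: crep_pp.
rewrite mulrnBl -sumrMnl pull_add pull_opp pull_sum pull_sscale.
apply: crepB; last by apply: crep_mulrn; exact: crep_lift_T.
apply: crep_sum => b; rewrite -pull_pd -raddfMn.
by apply: crep_dx; exact: crep_S.
Qed.

(** The coordinate form of Delta, read in the calculus. *)
Lemma lift_Delta f : lift (Delta V f) = second_order_op half_S lift_T (lift f).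
Proof.
case: local => _ _ _ hD. apply: (crep_inj (crep_lift _)).
have E : crep (second_order_op half_S lift_T (lift f)) (pull (sscale 2^-1
     (\sum_a \sum_b smul (Sc a b) (pd b (pd a (coef c f))))
   + \sum_a smul (Tc a) (pd a (coef c f)))).
  rewrite pull_add sscale_sum !pull_sum; apply: crepD; apply: crep_sum => a.
    rewrite sscale_sum pull_sum; apply: crep_sum => b.
    rewrite -smul_scale pull_smul -!pull_pd; apply: crepM; first exact: crep_half_S.
    by do 2!apply: crep_dx; exact: crep_lift.
  rewrite pull_smul -pull_pd; apply: crepM; first exact: crep_lift_T.
  by apply: crep_dx; exact: crep_lift.
apply: crep_eq E; apply: pull_ext => I x Wx.
by rewrite hD.
Qed.

Context (SS : eq_on (cotangent (cmap c @` cdom c)) (poisson (symbol Sc) (symbol Sc)) 0).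

Lemma half_SS0 : poisson_sc (symb2 half_S) (symb2 half_S) = 0.
Proof.
apply/(crep_eq0 (crep_poisson crep_symbol crep_symbol)) => I z Wz.
by apply: SS; exact: sW.
Qed.

Lemma local_flat_derivation :
  eq_on (cotangent (cmap c @` cdom c)) (poisson (symbol Sc) (upper_connection Sc Tc)) 0 ->
  forall p f g, homog p f ->
    Delta V (Delta V (f * g)) = Delta V (Delta V f) * g + f * Delta V (Delta V g).
Proof.
move=> flat p f g hf; apply: (@lift_inj _ _ _ _ _ _ oV sV).
have fl : poisson_sc (symb2 half_S) (Gamma half_S lift_T) = 0.
  apply/(crep_eq0 (crep_poisson crep_symbol crep_upper)) => I z Wz.
  by apply: flat; exact: sW.
have hlf : has_parity p (lift f) by exact: lift_parity.
rewrite liftD !liftM !lift_Delta liftM.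
exact: (flat_second_order_sqr half_S_sym half_S_parity lift_T_parity half_S_free
  lift_T_free half_SS0 fl _ hlf).
Qed.

(** The coordinate functions are lifts of sections, so that second_order_sqr_flat
applies. *)
Lemma local_derivation_flat :
  (forall f g, Delta V (Delta V (f * g)) =
     Delta V (Delta V f) * g + f * Delta V (Delta V g)) ->
  eq_on (cotangent W) (poisson (symbol Sc) (upper_connection Sc Tc)) 0.
Proof.
move=> der; apply/(crep_eq0 (crep_poisson crep_symbol crep_upper)).
apply: (second_order_sqr_flat half_S_sym half_S_parity lift_T_parity half_S_free
  lift_T_free half_SS0) => a b.
have coord e : exists f, lift f = xx e.
  have [f hf] := coef_surj oV sV (@ssmooth_coord R n m W e).
  exists f; apply: (crep_inj (crep_lift f)).
  apply: (@crep_eq R n m W (xx e) (scoord (pos_ix e))); last exact: crep_xx.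
  by rewrite -pull_scoord; apply: pull_ext => I x Wx; rewrite hf.
have [f <-] := coord a; have [g <-] := coord b.
by rewrite -!lift_Delta -!liftM -liftD -der -!lift_Delta.
Qed.

End LocalForm.

(** * The two properties on a supermanifold *)

Section Global.
Local Open Scope classical_set_scope.
Context {R : realType} {M : superspace R} {Delta : operator M}.
Implicit Types (p : bool).

Definition square_derivation := forall U, open U -> forall f g : sec U,
  Delta U (Delta U (f * g)) = Delta U (Delta U f) * g + f * Delta U (Delta U g).

Lemma additive_sign U p (f : @sec R M U) : Delta U ((-1) ^+ p * f) = (-1) ^+ p * Delta U f.
Proof. exact: raddfMsign. Qed.

(** The failure of Delta to be a derivation of its bracket equals the failure of
Delta^2 to be a derivation of the product. *)
Lemma derivation_defect U p (f g : @sec R M U) :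
  Delta U (bracket Delta p f g) + bracket Delta (~~ p) (Delta U f) g +
    (-1) ^+ p * bracket Delta p f (Delta U g) =
  Delta U (Delta U (f * g)) -
    (Delta U (Delta U f) * g + f * Delta U (Delta U g)).
Proof.
rewrite /bracket !raddfB /= additive_sign !mulrBr.
have -> : (-1) ^+ (~~ p) * (Delta U f * Delta U g) =
    - ((-1) ^+ p * (Delta U f * Delta U g)).
  by case: p; rewrite ?mulN1r ?mul1r ?opprK.
rewrite [(-1) ^+ p * ((-1) ^+ p * _)]mulrA -expr2 sqrr_sign mul1r opprK.
rewrite [LHS](AC (3*3*3) ((1*5*9)*(2*4)*(3*7)*(6*8))) /=.
by rewrite !addNr subrr !addr0 opprD addrA.
Qed.

Context (Delta_odd : op_homog true Delta).

Lemma bracket_derivationE : bracket_derivation Delta <-> square_derivation.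
Proof.
split=> h U oU.
  move=> f g; have [f0 [f1 [h0 h1 ->]]] := homog_sum f.
  have e p f' : homog p f' -> Delta U (Delta U (f' * g)) =
      Delta U (Delta U f') * g + f' * Delta U (Delta U g).
    move=> hf; apply/eqP; rewrite -subr_eq0 -(derivation_defect p) (h U oU p f' g hf).
    by rewrite addrAC subrK addNr.
  by rewrite mulrDl !raddfD /= (e _ _ h0) (e _ _ h1) !mulrDl addrACA.
move=> p f g hf; apply/eqP; rewrite -subr_eq0 opprD !opprK addrA derivation_defect.
by rewrite (h U oU) subrr.
Qed.

(** A Poisson vector field is in particular a derivation of the product; conversely,
Delta^2 differentiates the bracket because Delta does. *)
Lemma poisson_vector_fieldE :
  poisson_vector_field Delta (op_comp Delta Delta) <-> square_derivation.
Proof.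
split=> [[[_ h] _] U oU f g|h]; first exact: h.
have br := iffRL bracket_derivationE h.
split; first split.
- move=> U oU q f hf; rewrite -[false (+) q]/q.
  have := Delta_odd oU (Delta_odd oU hf); rewrite /= negbK; exact.
- by move=> U oU f g; exact: h.
move=> U oU p f g hf; rewrite /=.
rewrite (br U oU p f g hf) raddfB raddfN /= additive_sign (br U oU _ _ _ (Delta_odd oU hf)).
rewrite (br U oU p f (Delta U g) hf).
have -> : (-1) ^+ (true (+) p) = - (-1) ^+ p :> sec U by case: (p); rewrite ?opprK.
rewrite -[true (+) p]/(~~ p) negbK.
move: (bracket _ _ (_ (_ f)) g) (bracket _ _ (_ f) _) (bracket _ _ f _) => A B C.
rewrite mulNr opprK mulrBr mulrN !opprD !opprK.
by rewrite [(-1) ^+ p * ((-1) ^+ p * _)]mulrA -expr2 sqrr_sign mul1r addrA subrK.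
Qed.

End Global.

Section Manifold.
Local Open Scope classical_set_scope.

(** Functions are separated by their restrictions to chart domains, and non-homogeneous
functions are split into their even and odd parts. *)
Lemma square_derivation_flat (R : realType) (n m : nat) (M : supermanifold R n m)
    (Delta : operator M) : odd_second_order n m Delta -> schouten n m Delta ->
  @square_derivation R M Delta <-> flat_upper_connection n m Delta.
Proof.
move=> [Delta_odd local] hS; split=> [der c S T lf|flat U oU f g].
  exact: (@local_derivation_flat _ _ _ _ _ _ _ _ lf _ (cdom_open c) (fun x Vx => Vx)
    (hS c S T lf) (der _ (cdom_open c))).
have homog_case p (f' : sec U) : homog p f' -> Delta U (Delta U (f' * g)) =
    Delta U (Delta U f') * g + f' * Delta U (Delta U g).
  move=> hf.
  pose C : set (set (pt M)) := [set V | [/\ open V, V `<=` U &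
    exists c : chart n m M, V `<=` cdom c]].
  apply: (@sheaf_sep _ M C U oU).
  - by move=> V [].
  - rewrite eqEsubset; split=> [x [V [_ VU _] /VU //]|x Ux].
    have [c cx] := sm_chart x; exists (U `&` cdom c); last by [].
    split; [exact: openI (cdom_open c) | by move=> y [] | by exists c => y []].
  move=> V h [oV _ [c sV]].
  have [S [T lf]] := local c.
  rewrite rmorphD !rmorphM !op_res rmorphM.
  apply: (local_flat_derivation lf oV sV (hS c S T lf) (flat c S T lf)).
  exact: res_homog hf.
have [f0 [f1 [h0 h1 ->]]] := homog_sum f.
by rewrite mulrDl !raddfD /= (homog_case _ _ h0) (homog_case _ _ h1) !mulrDl addrACA.
Qed.

End Manifold.

Theorem theorem3p3 (R : realType) (n m : nat) (M : supermanifold R n m)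
    (Delta : operator M) (hDelta : odd_second_order n m Delta)
    (hS : schouten n m Delta) :
  (bracket_derivation Delta <-> flat_upper_connection n m Delta) /\
  (poisson_vector_field Delta (op_comp Delta Delta) <->
     flat_upper_connection n m Delta).
Proof.
have E := square_derivation_flat hDelta hS.
by rewrite bracket_derivationE (poisson_vector_fieldE hDelta.1).
Qed.
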